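(* Let $\alpha_1,\alpha_2,\beta_1,\beta_2>0$, $\nu\in(0,1)$, let $X^\nu(t):=X^1(T^\nu(t))$ be the time-changed process described in the context, and let $\Lambda$ be the function in the context. Set $$\Lambda_\nu(\gamma):=\begin{cases}(\Lambda(\gamma))^{1/\nu}&\text{if }\Lambda(\gamma)\geq0,\\0&\text{if }\Lambda(\gamma)<0.\end{cases}$$ Then, for all $k\in\mathbb{Z}$, the family of laws $\left\{P\left(\frac{X^\nu(t)}{t}\in\cdot\,\Big|\,X^\nu(0)=k\right):t>0\right\}$ on $\mathbb{R}$ satisfies the large deviation principle with speed function $v_t=t$ and good rate function $\Lambda_\nu^*(y):=\sup_{\gamma\in\mathbb{R}}\{\gamma y-\Lambda_\nu(\gamma)\}$.
   Context: $\{X^1(t):t\geq 0\}$ is the continuous-time Markov chain on $\mathbb{Z}$ whose state probabilities $p_{k,n}(t):=P(X^1(t)=n|X^1(0)=k)$ satisfy $p_{k,n}(0)=1_{\{k=n\}}$ and whose generator $g_{k,n}:=\lim_{t\to 0}\frac{p_{k,n}(t)-p_{k,n}(0)}{t}$ is as follows. For even $k$: $g_{k,k+1}=\alpha_1$, $g_{k,k-1}=\alpha_2$, $g_{k,k}=-(\alpha_1+\alpha_2)$. For odd $k$: $g_{k,k+1}=\beta_1$, $g_{k,k-1}=\beta_2$, $g_{k,k}=-(\beta_1+\beta_2)$. All other entries are $0$. $\{S^\nu(t):t\geq0\}$ is the $\nu$-stable subordinator, with $\mathbb{E}[e^{\gamma S^\nu(t)}]=e^{-|\gamma|^\nu t}$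 for $\gamma\leq0$, and $\{T^\nu(t):t\geq0\}$ is its inverse, $T^\nu(t)=\inf\{s\geq0:S^\nu(s)>t\}$; it is independent of $X^1$, $T^\nu(0)=0$, and $\mathbb{E}[e^{\gamma T^\nu(t)}]=E_\nu(\gamma t^\nu)$, where $E_\nu(x):=\sum_{j\geq0}\frac{x^j}{\Gamma(\nu j+1)}$ is the Mittag-Leffler function. For $z>0$, $h(z):=\frac12\sqrt{(\alpha_1+\alpha_2-(\beta_1+\beta_2))^2z^2+4(\beta_1z^2+\beta_2)(\alpha_1z^2+\alpha_2)}$; for $\gamma\in\mathbb{R}$, $\Lambda(\gamma):=\frac{h(e^\gamma)}{e^\gamma}-\frac{\alpha_1+\alpha_2+\beta_1+\beta_2}{2}$. Large deviation principle: a family of probability measures $\{\pi_t:t>0\}$ on a topological space $\mathcal{Y}$ satisfies the large deviation principle with rate function $I$ and speed function $v_t$ if $\lim_{t\to+\infty}v_t=+\infty$, $I:\mathcal{Y}\to[0,+\infty]$ is lower semicontinuous, $\liminf_{t\to+\infty}\frac{1}{v_t}\log\pi_t(O)\geq-\inf_{y\in O}I(y)$ for all open sets $O$, and $\limsup_{t\to+\infty}\frac{1}{v_t}\log\pi_t(C)\leq-\inf_{y\in C}I(y)$ for all closed sets $C$. The rate function $I$ is good if all level sets $\{y\in\mathcal{Y}:I(y)\leq\eta\}$, $\eta\geq0$, are compact. *)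

(* Defs.v *)
From HB Require Import structures.
From mathcomp Require Export all_boot all_order all_algebra.
From mathcomp Require Export all_classical all_reals all_analysis.
Export Order.TTheory GRing.Theory Num.Theory.
Export numFieldNormedType.Exports.
Set Implicit Arguments.
Unset Strict Implicit.
Unset Printing Implicit Defensive.
Local Open Scope classical_set_scope.
Local Open Scope ring_scope.

(* All processes are indexed by the reals; only their values at times t >= 0
   are ever constrained or used. *)

Section large_deviations.
Variables (R : realType) (Y : ptopologicalType).
Local Open Scope ereal_scope.

Definition is_borel_probability (m : set Y -> \bar R) : Prop :=
  exists mu : probability (g_sigma_algebraType (@open Y)) R,
    forall A : set Y, <<s @open Y >> A -> m A = mu A.

(* [lne] is the extended logarithm, with [lne 0 = -oo]; an infimum over the
   empty set is [+oo]. *)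
Definition satisfies_LDP (pi : R -> set Y -> \bar R) (v : R -> R)
    (I : Y -> \bar R) : Prop :=
  [/\ forall t : R, (0 < t)%R -> is_borel_probability (pi t),
      v t @[t --> +oo%R] --> +oo%R,
      (forall y, 0 <= I y) /\ lower_semicontinuous I,
      forall O : set Y, open O ->
        - ereal_inf (I @` O) <=
          limf_einf (fun t => ((v t)^-1)%:E * lne (pi t O)) (pinfty_nbhs R) &
      forall C : set Y, closed C ->
        limf_esup (fun t => ((v t)^-1)%:E * lne (pi t C)) (pinfty_nbhs R) <=
          - ereal_inf (I @` C)].

Definition good_rate_function (I : Y -> \bar R) : Prop :=
  forall eta : R, (0 <= eta)%R -> compact [set y | I y <= eta%:E].

End large_deviations.

Section markov_chains.
Variable R : realType.
Implicit Types (p : int -> int -> R -> R) (g : int -> int -> R).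

Definition transition_function p : Prop :=
  [/\ forall k n t, 0 <= t -> 0 <= p k n t,
      forall k t, 0 <= t -> \esum_(n in [set: int]) (p k n t)%:E = 1%E,
      forall k n, p k n 0 = (k == n)%:R &
      forall k n s t, 0 <= s -> 0 <= t ->
        (p k n (s + t))%:E =
          \esum_(l in [set: int]) (p k l s * p l n t)%:E].

Definition has_generator p g : Prop :=
  forall k n, (p k n t - p k n 0) / t @[t --> 0^'+] --> g k n.

(* Finite-dimensional form of the time-homogeneous Markov property, for an
   arbitrary initial law; the case [m = 0], [tau 0 = 0] says that
   [p k n t = P (X t = n | X 0 = k)].  The state space is discrete, so
   right-continuity means being constant on the right of each time. *)
Definition markov_chain d (W : measurableType d) (P : probability W R)
    (X : R -> W -> int) p : Prop :=
  [/\ transition_function p,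
      forall t k, 0 <= t -> measurable (X t @^-1` [set k]),
      forall w t, 0 <= t -> \forall s \near t^'+, X s w = X t w &
      forall (m : nat) (tau : nat -> R) (x : nat -> int),
        0 <= tau 0%N -> (forall i, (i <= m)%N -> tau i < tau i.+1) ->
        P (\bigcap_(i in `I_m.+2) X (tau i) @^-1` [set x i]) =
          (P (\bigcap_(i in `I_m.+1) X (tau i) @^-1` [set x i]) *
           (p (x m) (x m.+1) (tau m.+1 - tau m))%:E)%E].

Definition alternating_generator (a1 a2 b1 b2 : R) (k n : int) : R :=
  let up := if (2 %| k)%Z then a1 else b1 in
  let down := if (2 %| k)%Z then a2 else b2 in
  if n == k + 1 then up
  else if n == k - 1 then down
  else if n == k then - (up + down)
  else 0.

End markov_chains.

Section subordinators.
Variables (R : realType) (d : measure_display) (W : measurableType d).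
Variable P : probability W R.

(* A Levy process with nondecreasing right-continuous paths; the Laplace
   transform fixes the normalization.  Path properties hold surely, so that
   a process time-changed by the inverse of [S] is measurable on any probability space. *)
Definition stable_subordinator (nu : R) (S : R -> W -> R) : Prop :=
  [/\ forall t, 0 <= t -> measurable_fun [set: W] (S t),
      forall w, [/\ S 0 w = 0,
        forall s t, 0 <= s -> s <= t -> S s w <= S t w &
        forall t, 0 <= t -> S s w @[s --> t^'+] --> S t w],
      forall (m : nat) (tau : nat -> R) (B : nat -> set R),
        0 <= tau 0%N -> (forall i, (i < m)%N -> tau i < tau i.+1) ->
        (forall i, measurable (B i)) ->
        P (\bigcap_(i in `I_m) [set w | B i (S (tau i.+1) w - S (tau i) w)]) =
          (\prod_(i < m) P [set w | B i (S (tau i.+1) w - S (tau i) w)%R])%E,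
      forall s t (B : set R), 0 <= s -> 0 <= t -> measurable B ->
        P [set w | B (S (s + t) w - S s w)] = P [set w | B (S t w)] &
      forall t gamma, 0 <= t -> gamma <= 0 ->
        mmt_gen_fun P (S t) gamma = (expR (- (`|gamma| `^ nu * t)))%:E].

(* [inf] is 0 on the empty set, which only matters on the null event where the
   path [S ^~ w] is bounded. *)
Definition inverse_process (S : R -> W -> R) (t : R) (w : W) : R :=
  inf [set s | 0 <= s /\ t < S s w].

(* The sigma-algebra generated by [Z t], [t >= 0], where [G] is the
   sigma-algebra of the state space. *)
Definition process_sigma (E : Type) (G : set (set E)) (Z : R -> W -> E) :
    set (set W) :=
  <<s [set A | exists t B, [/\ 0 <= t, G B & A = Z t @^-1` B]] >>.

Definition independent_processes (E E' : Type) (G : set (set E))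
    (G' : set (set E')) (Z : R -> W -> E) (Z' : R -> W -> E') : Prop :=
  forall A B, process_sigma G Z A -> process_sigma G' Z' B ->
    P (A `&` B) = (P A * P B)%E.

Definition cond_prob (A B : set W) : \bar R :=
  (P (A `&` B) * ((fine (P B))^-1)%:E)%E.

End subordinators.

Section rate_function.
Variables (R : realType) (a1 a2 b1 b2 nu : R).

Definition h (z : R) : R :=
  2^-1 * Num.sqrt ((a1 + a2 - (b1 + b2)) ^+ 2 * z ^+ 2 +
                   4 * (b1 * z ^+ 2 + b2) * (a1 * z ^+ 2 + a2)).

Definition Lambda (gamma : R) : R :=
  h (expR gamma) / expR gamma - (a1 + a2 + b1 + b2) / 2.

Definition Lambda_nu (gamma : R) : R :=
  if 0 <= Lambda gamma then Lambda gamma `^ (1 / nu) else 0.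

Definition Lambda_nu_star (y : R) : \bar R :=
  ereal_sup [set (gamma * y - Lambda_nu gamma)%:E | gamma in [set: R]].

End rate_function.

(* Main.v *)
(* The chain [X1] is a birth-death chain with bounded rates, and a function of
   the form [u n = exp (gamma n) * v (parity n)] is an eigenfunction of its
   generator with eigenvalue [Lambda gamma], the Perron root of a 2 x 2 matrix.
   A maximum principle for the backward equation gives
   [E_k (u (X1 t)) = exp (Lambda gamma * t) * u k], hence, by independence, the
   exponential moments of [X1 (T t)] agree up to constants with
   [E (exp (Lambda gamma * T t))].  The Laplace transform of the stable
   subordinator, through [T t > s -> S s <= t] and [S s <= t -> s <= T t]
   (almost surely), yields the growth rate [theta^(1/nu)] of
   [E (exp (theta * T t))] for [theta >= 0], and [0] for [theta < 0].
   The logarithmic moments of [X^nu t] thus grow like [Lambda_nu], which is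
   differentiable because [1/nu > 1] and superlinear, and the Gartner-Ellis
   argument applies. *)
From HB Require Import structures.
Require Import Defs.
From mathcomp Require Import measurable_realfun ring lra zify.
Set Implicit Arguments.
Unset Strict Implicit.
Unset Printing Implicit Defensive.
Local Open Scope classical_set_scope.
Local Open Scope ring_scope.

(** * Large deviations from exponential moments *)

(** The main obstacle is the eigenfunction identity. The generator only gives derivatives at time
    [0], entry by entry and with no uniformity in the starting state, and [u] is unbounded.
    Chapman-Kolmogorov turns this into an Euler step of the backward equation whose error is uniform
    in the time and the target state, and the maximum principle is proved for such steps. It asks
    for an upper bound uniform in the state: for one inequality [u] is truncated to finite sums, for
    the other a faster growing Lyapunov function is subtracted with a small weight.

    One local estimate, which compares the moment at [g] with those at [g + e] and [g - e], serves
    twice: in the large deviation lower bound, and for the subordinator tilted by [- g]. The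
    exponent [1 / nu] appears there as the solution [g = theta^(1/nu)] of [g^nu = theta], which is
    also the threshold of convergence in the upper bound for the moments of [T t].

    Superlinearity makes every real [y] a slope of the limiting function, so the lower bound is
    available at every point of an open set. *)

Section level_sets.
Context d (W : measurableType d) (R : realType) (Z : W -> R).
Hypothesis mZ : measurable_fun setT Z.

Lemma measurable_set_le c : measurable [set w | Z w <= c].
Proof.
have := mZ measurableT (measurable_itv `]-oo, c]); rewrite setTI.
by congr measurable; apply/seteqP; split => w; rewrite /= in_itv.
Qed.

Lemma measurable_set_gt c : measurable [set w | c < Z w].
Proof.
have := mZ measurableT (measurable_itv `]c, +oo[); rewrite setTI.
by congr measurable; apply/seteqP; split => w; rewrite /= in_itv/= andbT.
Qed.

End level_sets.

Lemma measurable_set_dist_lt d (W : measurableType d) (R : realType)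
    (Z : W -> R) m r : measurable_fun setT Z ->
  measurable [set w | `|Z w - m| < r].
Proof.
move=> mZ; have mD : measurable_fun setT (fun w => - `|Z w - m|).
  apply: measurableT_comp => //; apply: measurableT_comp => //.
  exact: measurable_funB.
have := measurable_set_gt mD (- r); congr measurable.
by apply/seteqP; split => w /=; rewrite ltrN2.
Qed.

Section exponential_moments.
Context d (W : measurableType d) (R : realType) (Q : probability W R).
Implicit Types Z : W -> R.
Local Open Scope ereal_scope.

Lemma mmt_gen_funE Z g : 'M_Q Z g = \int[Q]_w (expR (g * Z w))%:E.
Proof.
rewrite /mmt_gen_fun unlock; apply: eq_integral => w _ /=.
by rewrite mulrC.
Qed.

Lemma measurable_expRM Z g : measurable_fun setT Z ->
  measurable_fun setT (fun w => (expR (g * Z w))%:E).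
Proof.
move=> mZ; apply/measurable_EFinP; apply: measurableT_comp => //.
exact: measurable_funM.
Qed.

(** The exponential Chebyshev inequality. It serves both ways: to bound probabilities above by
    moments, and moments below by probabilities. *)
Lemma expR_prob_le_mmt Z (g c : R) (A : set W) : measurable_fun setT Z ->
  measurable A -> (forall w, A w -> (c <= g * Z w)%R) ->
  (expR c)%:E * Q A <= 'M_Q Z g.
Proof.
move=> mZ mA cA; rewrite mmt_gen_funE -(setIT A) -integral_indic//.
rewrite -ge0_integralZl_EFin ?expR_ge0//; last first.
  exact/measurable_EFinP/measurable_indic.
apply: ge0_le_integral => //.
- by apply: measurable_funeM; exact/measurable_EFinP/measurable_indic.
- exact: measurable_expRM.
- move=> w _; rewrite -EFinM lee_fin indicE.
  have [/set_mem Aw|_] := boolP (w \in A).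
    by rewrite mulr1 ler_expR cA.
  by rewrite mulr0 expR_ge0.
Qed.

(* Off the ball, [exp (g Z)] is dominated by a tilted exponential on either
   side; this replaces the usual change of measure in the lower bound. *)
Lemma mmt_le_tilt Z (g m r e e' : R) : measurable_fun setT Z ->
  (0 <= e)%R -> (0 <= e')%R ->
  'M_Q Z g <= (expR (g * m + `|g| * r))%:E * Q [set w | `|Z w - m| < r]%R +
    ((expR (- (e * (m + r))))%:E * 'M_Q Z (g + e)%R +
     (expR (e' * (m - r)))%:E * 'M_Q Z (g - e')%R).
Proof.
move=> mZ e0 e'0; rewrite !mmt_gen_funE.
set B := [set w | _]; have mB : measurable B by exact: measurable_set_dist_lt.
rewrite -{1}(setIT B) -integral_indic//.
rewrite -!ge0_integralZl_EFin ?expR_ge0//; try (exact: measurable_expRM);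
  try (by move=> w _; rewrite lee_fin ?expR_ge0);
  try (exact/measurable_EFinP/measurable_indic).
have m1 h c : measurable_fun setT (fun w => (expR c)%:E * (expR (h * Z w))%:E).
  by apply: measurable_funeM; exact: measurable_expRM.
have m2 : measurable_fun setT (fun w =>
    (expR (g * m + `|g| * r))%:E * (\1_B w)%:E).
  by apply: measurable_funeM; exact/measurable_EFinP/measurable_indic.
rewrite -ge0_integralD// -ge0_integralD//; last 2 first.
- by move=> w _; rewrite adde_ge0// mule_ge0// lee_fin ?expR_ge0.
- exact: emeasurable_funD.
apply: ge0_le_integral => //.
- exact: measurable_expRM.
- by do !apply: emeasurable_funD.
move=> w _; rewrite -!EFinM -!EFinD lee_fin indicE.
have [/set_mem Bw|/negP nBw] := boolP (w \in B).
  rewrite mulr1 ler_wpDr ?addr_ge0 ?mulr_ge0 ?expR_ge0// ler_expR.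
  have : (g * (Z w - m) <= `|g| * r)%R.
    by rewrite (le_trans (ler_norm _))// normrM ler_wpM2l// ltW.
  lra.
rewrite mulr0 add0r -!expRD.
have : (r <= `|Z w - m|)%R by rewrite leNgt; apply/negP => /mem_set.
rewrite ler_normr => /orP[rZ|rZ].
  rewrite ler_wpDr ?expR_ge0// ler_expR.
  have := ler_wpM2l e0 rZ; lra.
rewrite ler_wpDl ?expR_ge0// ler_expR.
have := ler_wpM2l e'0 rZ; lra.
Qed.

End exponential_moments.

Section local_lower_bound.
Context d (W : measurableType d) (R : realType) (Q : probability W R).
Variables (Z : R -> W -> R) (g y delta l lp lm e e' : R).
Hypothesis mZ : forall t : R, 0 < t -> measurable_fun setT (Z t).
Hypotheses (e0 : 0 <= e) (e'0 : 0 <= e').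
Hypothesis ltlp : lp - e * (y + delta) < l.
Hypothesis ltlm : lm + e' * (y - delta) < l.
Hypothesis Ml : forall eta : R, 0 < eta ->
  \forall t \near +oo, ((expR (t * (l - eta)))%:E <= 'M_Q (Z t) g)%E.
Hypothesis Mp :
  \forall t \near +oo, ('M_Q (Z t) (g + e) <= (expR (t * lp))%:E)%E.
Hypothesis Mm :
  \forall t \near +oo, ('M_Q (Z t) (g - e') <= (expR (t * lm))%:E)%E.

(** In [mmt_le_tilt] at [m = t y] and [r = t delta], the hypotheses [ltlp] and [ltlm] make both
    tilted terms exponentially smaller than the moment at [g], so the ball has to carry that
    moment. *)
Lemma local_lower_bound (eta : R) : 0 < eta -> \forall t \near +oo,
  ((expR (t * (l - g * y - `|g| * delta - eta)))%:E <=
   Q [set w | `|Z t w - t * y| < t * delta]%R)%E.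
Proof.
move=> eta0.
(* The moment is at least [exp (t (l - k))] and each tilted term at most [exp (t (l - 2 k))]; the
   final loss [2 k] has to stay below [eta]. *)
pose k := Num.min (eta / 2) (Num.min ((l - (lp - e * (y + delta))) / 2)
   ((l - (lm + e' * (y - delta))) / 2)).
have k0 : 0 < k.
  by rewrite /k !lt_min divr_gt0//= !divr_gt0// subr_gt0.
have [k1 k2 k3] : [/\ k <= eta / 2, k <= (l - (lp - e * (y + delta))) / 2 &
    k <= (l - (lm + e' * (y - delta))) / 2].
  by rewrite /k !ge_min !lexx !orbT.
near=> t.
have t0 : 0 < t by near: t; exact: nbhs_pinfty_gt.
have t3 : 3 / k <= t by near: t; apply: nbhs_pinfty_ge; rewrite num_real.
(* The moment is thus worth four times [exp (t (l - 2 k))]; the two tails use up at most two of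
   these. *)
have tk : 4 <= expR (t * k).
  rewrite (le_trans _ (expR_ge1Dx _))//; move: t3; rewrite ler_pdivrMr//; lra.
have := mmt_le_tilt Q g (t * y) (t * delta) (mZ t0) e0 e'0.
set q := Q _ => tilt.
have qfin : q \is a fin_num.
  by apply: fin_num_measure; apply: measurable_set_dist_lt; exact: mZ.
have : ((expR (t * (l - k)))%:E <=
   (expR (g * (t * y) + `|g| * (t * delta)) * fine q +
    (expR (t * (l - 2 * k)) + expR (t * (l - 2 * k))))%:E)%E.
  apply: (@le_trans _ _ ('M_Q (Z t) g)).
    by near: t; exact: Ml.
  apply: le_trans tilt _; rewrite EFinD EFinM fineK// leeD2l// EFinD leeD//.
    apply: (@le_trans _ _ ((expR (- (e * (t * y + t * delta))))%:E *
        (expR (t * lp))%:E)%E).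
      by rewrite lee_wpmul2l ?lee_fin ?expR_ge0//; near: t.
    rewrite -EFinM -expRD lee_fin ler_expR.
    rewrite [leLHS](_ : _ = t * (lp - e * (y + delta))); last by ring.
    rewrite ler_pM2l//; lra.
  apply: (@le_trans _ _ ((expR (e' * (t * y - t * delta)))%:E *
      (expR (t * lm))%:E)%E).
    by rewrite lee_wpmul2l ?lee_fin ?expR_ge0//; near: t.
  rewrite -EFinM -expRD lee_fin ler_expR.
  rewrite [leLHS](_ : _ = t * (lm + e' * (y - delta))); last by ring.
  rewrite ler_pM2l//; lra.
rewrite lee_fin => tilt'.
rewrite -(fineK qfin) lee_fin.
have E1 : expR (t * (l - k)) = expR (t * (l - 2 * k)) * expR (t * k).
  by rewrite -expRD; congr expR; ring.
have E2 : expR (t * (l - 2 * k)) <=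
    expR (g * (t * y) + `|g| * (t * delta)) * fine q.
  have := ler_wpM2l (expR_ge0 (t * (l - 2 * k))) tk.
  rewrite -E1; have := expR_ge0 (t * (l - 2 * k)); lra.
rewrite -(ler_pM2l (expR_gt0 (g * (t * y) + `|g| * (t * delta)))).
apply: le_trans E2; rewrite -expRD ler_expR.
rewrite [leLHS](_ : _ = t * (l - eta)); last by ring.
rewrite ler_pM2l//; lra.
Unshelve. all: by end_near. Qed.

End local_lower_bound.

Section limf.
Context (R : realType) (T : choiceType) (X : filteredType T).
Context (F : set_system X) (f : X -> \bar R).
Local Open Scope ereal_scope.

Lemma limf_esup_le c : (\forall t \near F, f t <= c) -> limf_esup f F <= c.
Proof.
move=> Fc; apply: (@le_trans _ _ (ereal_sup (f @` [set t | f t <= c]))).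
  by apply: ereal_inf_lbound; exists [set t | f t <= c].
by apply: ge_ereal_sup => _ [t ? <-].
Qed.

Lemma limf_einf_ge c : (\forall t \near F, c <= f t) -> c <= limf_einf f F.
Proof.
move=> Fc; rewrite limf_einfE.
apply: (@le_trans _ _ (ereal_inf (f @` [set t | c <= f t]))); last first.
  by apply: ereal_sup_ubound; exists [set t | c <= f t].
by apply: le_ereal_inf_tmp => _ [t ? <-].
Qed.

End limf.

Section scaled_log.
Context (R : realType).
Local Open Scope ereal_scope.

Lemma scaled_lne_le (t c : R) (q : \bar R) : (0 < t)%R -> 0 <= q ->
  q <= (expR (t * c))%:E -> (t^-1)%:E * lne q <= c%:E.
Proof.
move=> t0 q0 qc; rewrite muleC lee_pdivrMr//.
rewrite (_ : c%:E * t%:E = lne (expR (t * c))%:E); last first.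
  by rewrite lne_EFin ?expR_gt0// expRK -EFinM mulrC.
by rewrite lee_lne// in_itv/= ?q0 ?leey// lee_fin expR_ge0.
Qed.

Lemma scaled_lne_ge (t c : R) (q : \bar R) : (0 < t)%R ->
  (expR (t * c))%:E <= q -> c%:E <= (t^-1)%:E * lne q.
Proof.
move=> t0 qc; rewrite muleC lee_pdivlMr//.
rewrite (_ : c%:E * t%:E = lne (expR (t * c))%:E); last first.
  by rewrite lne_EFin ?expR_gt0// expRK -EFinM mulrC.
rewrite lee_lne// in_itv/= ?leey ?andbT ?lee_fin ?expR_ge0//.
by rewrite (le_trans _ qc)// lee_fin expR_ge0.
Qed.

(** Tests an inequality on real levels, so that an infinite infimum of the rate function needs no
    separate argument. *)
Lemma lee_real_lt (x y : \bar R) :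
  (forall a : R, a%:E < x -> a%:E <= y) -> x <= y.
Proof.
case: x => [r| |] xy //; last 2 first.
- suff -> : y = +oo by [].
  by apply/eqyP => a _; apply: xy; rewrite ltry.
- by rewrite leNye.
apply/lee_addgt0Pr => e e0; rewrite -leeBlDr// -EFinB.
by apply: xy; rewrite lte_fin ltrBlDr ltrDl.
Qed.

End scaled_log.

(** * Legendre transforms of superlinear functions *)

Section legendre.
Context (R : realType).

Definition legendre (L : R -> R) (y : R) : \bar R :=
  ereal_sup [set (g * y - L g)%:E | g in [set: R]].

Definition superlinear (L : R -> R) :=
  forall K : R, exists C, forall g, K * `|g| - C <= L g.

Variable L : R -> R.

Lemma le_legendre g y : ((g * y - L g)%:E <= legendre L y)%E.
Proof. by apply: ereal_sup_ubound; exists g. Qed.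

Lemma lt_legendre (a y : R) : (a%:E < legendre L y)%E ->
  exists g, a < g * y - L g.
Proof.
move=> /ereal_sup_gt[_ [g _ <-]]; rewrite lte_fin => ?; by exists g.
Qed.

Lemma open_affine_gt (a g c : R) : open [set y : R | a < g * y - c].
Proof.
apply: (@open_comp _ _ (fun y : R => g * y - c) [set x | a < x]); last first.
  exact: open_gt.
move=> y _; apply: cvgB; last exact: cvg_cst.
by apply: cvgM; [exact: cvg_cst|exact: cvg_id].
Qed.

Lemma lsc_legendre : lower_semicontinuous (legendre L).
Proof.
move=> x a /lt_legendre[g ag]; exists [set y : R | a < g * y - L g].
  by apply: open_nbhs_nbhs; split; [exact: open_affine_gt|].
move=> y /= ag'; apply: lt_le_trans (le_legendre g y).
by rewrite lte_fin.
Qed.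

Lemma legendre_good : good_rate_function (legendre L).
Proof.
move=> eta eta0.
(* The slopes [1] and [-1] alone confine a level set to [[-M, M]]. *)
pose M := eta + `|L 1| + `|L (-1)|.
rewrite (_ : [set y | _] =
    [set` `[-M, M]] `&` [set y | (legendre L y <= eta%:E)%E]); last first.
  apply/seteqP; split=> y /=; last by case.
  move=> Iy; split=> //; rewrite in_itv/=.
  have := le_trans (le_legendre 1 y) Iy.
  have := le_trans (le_legendre (-1) y) Iy.
  rewrite !lee_fin /M.
  have := ler_norm (L 1); have := ler_norm (L (-1)).
  have := normr_ge0 (L 1); have := normr_ge0 (L (-1)); lra.
apply: compact_closedI; first exact: segment_compact.
rewrite -openC (_ : ~` _ = [set y | (eta%:E < legendre L y)%E]).
  exact: (lower_semicontinuousP (legendre L)).1 lsc_legendre eta.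
by apply/seteqP; split => y /=; rewrite ltNge => /negP.
Qed.

Hypothesis dL : forall g : R, derivable L g 1.

(** Supplies the two strict inequalities that [local_lower_bound] asks for. The bound [rmax] keeps
    the tilted exponents in the range where moments are known: for the subordinator, the nonpositive
    ones. *)
Lemma derivable_near_slope (g y delta rmax : R) : is_derive g 1 L y ->
  0 < delta -> 0 < rmax -> exists2 e, 0 < e < rmax &
                     L (g + e) - L g < e * (y + delta) /\
                     L (g - e) - L g < - (e * (y - delta)).
Proof.
move=> [dLg Ly] d0 rmax0.
have : h^-1 *: ((L \o shift g) (h *: 1) - L g) @[h --> 0^'] --> y.
  rewrite -Ly.
  exact: dLg.
move=> /cvgrPdist_lt/(_ _ d0)/nbhs_ballP[r /= r0 ry].
have sl h : h != 0 -> `|h| < r -> `|y - h^-1 * (L (g + h) - L g)| < delta.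
  move=> h0 hr; have := ry h; rewrite /ball/= sub0r normrN => /(_ hr h0).
  by rewrite /= [h%:A]mulr1 [h + g]addrC.
have [e e0 /andP[er ermax]] : exists2 e : R, 0 < e & (`|e| < r) && (e < rmax).
  have m0 : 0 < Num.min r rmax by rewrite lt_min r0.
  exists (Num.min r rmax / 2); first by rewrite divr_gt0.
  rewrite gtr0_norm ?divr_gt0// -lt_min ltr_pdivrMr//; lra.
exists e; first by rewrite e0.
split.
  have := sl e (lt0r_neq0 e0) er; rewrite ltr_norml => /andP[+ _].
  rewrite -[X in _ -> X < _](mulVKf (lt0r_neq0 e0)) ltr_pM2l//; lra.
have ne0 : - e != 0 by rewrite oppr_eq0 lt0r_neq0.
have := sl (- e) ne0; rewrite normrN => /(_ er); rewrite ltr_norml => /andP[_].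
rewrite -[X in _ -> X < _](mulVKf ne0) mulNr ltrN2 ltr_pM2l//; lra.
Qed.

(** Superlinearity sends [g y - L g] to [-oo] on both sides, so a maximum exists and the derivative
    vanishes there. *)
Lemma legendre_exposed (y : R) : superlinear L -> exists g : R,
  is_derive g 1 L y /\ forall g', g' * y - L g' <= g * y - L g.
Proof.
move=> sL; have [C LC] := sL (`|y| + 1).
have phi_le g : g * y - L g <= C - `|g|.
  have := LC g; have : g * y <= `|g| * `|y| by rewrite -normrM ler_norm.
  lra.
(* Beyond [G] the bound [C - |g|] is below [- L 0], the value at [g = 0]; the maximum over [[-G, G]]
   is therefore global and interior. *)
pose G := `|C + L 0| + 1.
have G0 : 0 < G by rewrite ltr_wpDl.
have phi_out g : G <= `|g| -> g * y - L g < 0 * y - L 0.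
  move=> Gg; apply: le_lt_trans (phi_le g) _.
  by have := ler_norm (C + L 0); move: Gg; rewrite /G; lra.
have dphi (g : R) : derivable (fun g : R => g * y - L g) g 1.
  by apply: derivableB => //; apply: derivableM.
have GG : - G <= G by lra.
have [|g gG gmax] := @EVT_max R (fun g => g * y - L g) (- G) G GG.
  by apply: derivable_within_continuous => g _; exact: dphi.
have gmax' g' : g' * y - L g' <= g * y - L g.
  have [g'G|Gg'] := ltP `|g'| G.
    by apply: gmax; rewrite in_itv/= -ler_norml ltW.
  apply: le_trans (ltW (phi_out _ Gg')) _; apply: gmax.
  by rewrite in_itv/=; lra.
exists g; split => //.
have gGo : g \in `]- G, G[.
  rewrite in_itv/= -ltr_norml ltNge; apply/negP => /phi_out.
  by rewrite ltNge gmax'.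
have dmax := derive1_at_max GG (fun t _ => dphi t) gGo (fun t _ => gmax' t).
have Dy : is_derive g 1 ((id : R -> R) * cst y) y.
  by apply: is_derive_eq; rewrite /= scaler0 add0r; exact: mulr1.
have := is_deriveB Dy dmax; rewrite subr0; congr is_derive.
by apply/funext => x; exact: subKr.
Qed.

End legendre.

Section borel_probability.
Context d (W : measurableType d) (R : realType) (Q : probability W R).

Lemma is_borel_probability_image (Y : ptopologicalType) (f : W -> Y) :
  (forall O, open O -> measurable (f @^-1` O)) ->
  is_borel_probability (fun A => Q [set w | A (f w)]).
Proof.
move=> mfO.
have mf : measurable_fun [set: W] (f : W -> g_sigma_algebraType (@open Y)).
  refine (@measurability _ _ _ (g_sigma_algebraType (@open Y))
    _ _ (@open Y) _ _); first by [].
  move=> _ [V oV <-].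
  by rewrite setTI; exact: mfO.
pose X : {RV Q >-> g_sigma_algebraType (@open Y)} :=
  HB.pack (f : W -> g_sigma_algebraType (@open Y))
    (isMeasurableFun.Build _ _ _ _ _ mf).
by exists (distribution Q X) => A mA.
Qed.

End borel_probability.

(** * The Gartner-Ellis theorem *)

Section gartner_ellis.
Context d (W : measurableType d) (R : realType) (Q : probability W R).
Variables (Z : R -> W -> R) (L : R -> R).
Hypothesis mZ : forall t : R, 0 < t -> measurable_fun setT (Z t).
Hypothesis mmtL : forall g eta : R, 0 < eta -> \forall t \near +oo,
  ((expR (t * (L g - eta)))%:E <= 'M_Q (Z t) g <=
   (expR (t * (L g + eta)))%:E)%E.

Let law (t : R) (A : set R) := Q [set w | A (Z t w / t)].

Let measurable_scaled (t : R) (A : set R) : 0 < t -> measurable A ->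
  measurable [set w | A (Z t w / t)].
Proof.
move=> t0 mA; rewrite -[X in measurable X]setTI.
have : measurable_fun setT (fun w => Z t w / t).
  by apply: measurable_funM => //; exact: mZ.
exact.
Qed.

(** On this set [g Z] exceeds [t (a + L g)], so Chernoff's bound with the same [g] gives the rate
    [a] whatever [g] is. *)
Lemma prob_affine_gt_le (a g eta : R) : 0 < eta -> \forall t \near +oo,
  (law t [set y | (a < g * y - L g)%R] <= (expR (t * (eta - a)))%:E)%E.
Proof.
move=> eta0; near=> t.
have t0 : 0 < t by near: t; exact: nbhs_pinfty_gt.
rewrite -(lee_pmul2l (x := (expR (t * (a + L g)))%:E)) ?lte_fin ?expR_gt0//.
rewrite -EFinM -expRD.
apply: (@le_trans _ _ ('M_Q (Z t) g)).
  apply: expR_prob_le_mmt; first exact: mZ.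
    apply: measurable_scaled => //.
    by apply: open_measurable; exact: open_affine_gt.
  move=> w /= /ltW; rewrite -lerBlDr opprK => /(ler_wpM2l (ltW t0)) h.
  rewrite (le_trans h)// mulrCA (mulrCA t) divff ?mulr1// gt_eqF//.
have /andP[_ h] : ((expR (t * (L g - eta)))%:E <= 'M_Q (Z t) g <=
    (expR (t * (L g + eta)))%:E)%E by near: t; exact: mmtL.
apply: le_trans h _; rewrite lee_fin ler_expR le_eqVlt; apply/orP; left.
by apply/eqP; ring.
Unshelve. all: by end_near. Qed.

Lemma prob_union_affine_gt_le (a eta : R) (s : seq R) : 0 < eta ->
  \forall t \near +oo,
  (law t (\big[setU/set0]_(g <- s) [set y | (a < g * y - L g)%R]) <=
   ((size s)%:R * expR (t * (eta - a)))%:E)%E.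
Proof.
move=> eta0; elim: s => [|g s IH].
  near=> t; rewrite big_nil mul0r /law.
  by rewrite (_ : [set w | _] = set0)// measure0.
near=> t; have t0 : 0 < t by near: t; exact: nbhs_pinfty_gt.
rewrite big_cons /law; set U := \big[_/_]_(_ <- _) _.
have mA c : measurable [set y | (a < c * y - L c)%R].
  by apply: open_measurable; exact: open_affine_gt.
have mU : measurable U by apply: bigsetU_measurable.
rewrite (_ : [set w | _] = [set w | (a < g * (Z t w / t) - L g)%R] `|`
   [set w | U (Z t w / t)])//.
have mAU := measureU2 Q (measurable_scaled t0 (mA g)) (measurable_scaled t0 mU).
apply: le_trans mAU _.
rewrite -[(size _)%:R]natr1 addrC mulrDl mul1r EFinD leeD//.
  by near: t; exact: IH.
by near: t; exact: prob_affine_gt_le.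
Unshelve. all: by end_near. Qed.

(* The sets [{y | a < g y - L g}] cover [C]; [g = 1] and [g = -1] take care of a
   neighbourhood of infinity, so that finitely many of them suffice. *)
Lemma gartner_ellis_upper (C : set R) : closed C ->
  (limf_esup (fun t : R => (t^-1)%:E * lne (law t C)) (pinfty_nbhs R) <=
   - ereal_inf (legendre L @` C))%E.
Proof.
move=> clC; rewrite leeNr; apply: lee_real_lt => a aI.
rewrite leeNr.
have aC y : C y -> exists g, a < g * y - L g.
  move=> Cy; apply: lt_legendre; apply: lt_le_trans aI _.
  by apply: ereal_inf_lbound; exists y.
pose U g : set R := [set y | a < g * y - L g].
pose M := `|a| + `|L 1| + `|L (-1)| + 1.
have cK : compact (`[- M, M] `&` C).
  by apply: compact_closedI => //; exact: segment_compact.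
move: cK; rewrite compact_cover => /(_ R setT U).
case=> [g _|y [_ /aC[g ag]]|D _ DK]; [exact: open_affine_gt|by exists g|].
pose s : seq R := [:: 1, -1 & finmap.enum_fset D].
have Cs : C `<=` \big[setU/set0]_(g <- s) U g.
  move=> y Cy; rewrite -bigcup_seq.
  have [yM|My] := boolP (y \in `[- M, M]).
    have [g gD gy] := DK y (conj yM Cy).
    by exists g => //=; rewrite !inE gD !orbT.
  have na := ler_norm a; have na' := normr_ge0 a.
  have n1 := ler_norm (L 1); have n1' := normr_ge0 (L 1).
  have n2 := ler_norm (L (-1)); have n2' := normr_ge0 (L (-1)).
  move: My; rewrite in_itv/= negb_and -!ltNge => /orP[yM|yM].
    exists (-1) => /=; first by rewrite !inE eqxx orbT.
    by rewrite /U/=; move: yM; rewrite /M; lra.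
  exists 1 => /=; first by rewrite !inE eqxx.
  by rewrite /U/=; move: yM; rewrite /M; lra.
have mU : measurable (\big[setU/set0]_(g <- s) U g).
  apply: bigsetU_measurable => g _; apply: open_measurable.
  exact: open_affine_gt.
rewrite -EFinN; apply/lee_addgt0Pr => e e0; rewrite -EFinD.
have e20 : 0 < e / 2 by rewrite divr_gt0.
apply: limf_esup_le; near=> t.
have t0 : 0 < t by near: t; exact: nbhs_pinfty_gt.
apply: scaled_lne_le => //.
apply: (@le_trans _ _ (law t (\big[setU/set0]_(g <- s) U g))).
  apply: (le_measure Q); rewrite ?inE.
  - by apply: measurable_scaled => //; exact: closed_measurable.
  - exact: measurable_scaled.
  - by move=> w; exact: Cs.
apply: (@le_trans _ _ ((size s)%:R * expR (t * (e / 2 - a)))%:E).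
  near: t; exact: (prob_union_affine_gt_le a s e20).
rewrite lee_fin.
(* One half of [e] absorbs the number of sets in the cover, the other half the error in the
   moments. *)
apply: (@le_trans _ _ (expR (t * (e / 2)) * expR (t * (e / 2 - a)))).
  rewrite ler_wpM2r ?expR_ge0// (le_trans _ (expR_ge1Dx _))//.
  rewrite (@le_trans _ _ (t * (e / 2)))// ?lerDr// -ler_pdivrMr//.
by rewrite -expRD ler_expR le_eqVlt; apply/orP; left; apply/eqP; field.
Unshelve. all: by end_near. Qed.

Hypothesis dL : forall g : R, derivable L g 1.
Hypothesis sL : superlinear L.

(** For [g] of slope [y], [local_lower_bound] gives small balls around [y] a rate close to
    [L g - g y], and this is at least [- legendre L y] because the transform is a supremum. *)
Lemma gartner_ellis_lower (O : set R) : open O ->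
  (- ereal_inf (legendre L @` O) <=
   limf_einf (fun t : R => (t^-1)%:E * lne (law t O)) (pinfty_nbhs R))%E.
Proof.
move=> oO; rewrite leeNl; apply: le_ereal_inf_tmp => _ [y Oy <-]; rewrite leeNl.
have [g [Dg _]] := legendre_exposed dL y sL.
apply: (@le_trans _ _ (L g - g * y)%:E).
  by rewrite leeNl -EFinN opprB; exact: le_legendre.
apply/lee_addgt0Pr => eta eta0; rewrite -leeBlDr// -EFinB.
have [r /= r0 rO] : exists2 r : R, 0 < r & ball y r `<=` O.
  by have /nbhs_ballP := open_nbhs_nbhs (conj oO Oy).
(* [r] keeps the ball inside [O]; the other term limits the loss [|g| * delta] to [eta / 2]. *)
pose delta := Num.min r (eta / 2 / (`|g| + 1)).
have delta0 : 0 < delta.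
  by rewrite /delta lt_min r0/= !divr_gt0// ltr_wpDl.
have gdelta : `|g| * delta <= eta / 2.
  apply: (@le_trans _ _ ((`|g| + 1) * delta)).
    by rewrite ler_wpM2r// ?lerDl// ltW.
  by rewrite mulrC -ler_pdivlMr ?ltr_wpDl// /delta ge_min lexx orbT.
have [e /andP[e0 _] [ep em]] := derivable_near_slope Dg delta0 ltr01.
(* Half of the smaller gap: the upper rates [L (g + e) + k] and [L (g - e) + k] still satisfy the
   strict inequalities. *)
pose k := Num.min (e * (y + delta) - (L (g + e) - L g))
  (- (e * (y - delta)) - (L (g - e) - L g)) / 2.
have k0 : 0 < k by rewrite divr_gt0// lt_min !subr_gt0 ep em.
have [k1 k2] : 2 * k <= e * (y + delta) - (L (g + e) - L g) /\
    2 * k <= - (e * (y - delta)) - (L (g - e) - L g).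
  by rewrite /k mulrC divfK// !ge_min !lexx orbT.
have H := @local_lower_bound _ _ _ Q Z g y delta (L g) (L (g + e) + k)
  (L (g - e) + k) e e mZ (ltW e0) (ltW e0).
apply: limf_einf_ge; near=> t.
have t0 : 0 < t by near: t; exact: nbhs_pinfty_gt.
apply: scaled_lne_ge => //.
apply: (@le_trans _ _ (Q [set w | `|Z t w - t * y| < t * delta]%R)); last first.
  apply: (le_measure Q); rewrite ?inE.
  - by apply: measurable_set_dist_lt; exact: mZ.
  - by apply: measurable_scaled => //; exact: open_measurable.
  move=> w /= Zw; apply: rO; rewrite /ball/=.
  have : `|Z t w / t - y| < delta.
    rewrite -(ltr_pM2l t0) -[X in X * _ < _](gtr0_norm t0) -normrM mulrBr.
    by rewrite mulrCA divff ?mulr1// gt_eqF.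
  by rewrite distrC => /lt_le_trans; apply; rewrite /delta ge_min lexx.
apply: (@le_trans _ _ (expR (t * (L g - g * y - `|g| * delta - eta / 2)))%:E).
  by rewrite lee_fin ler_expR ler_pM2l//; lra.
near: t; apply: H; last by rewrite divr_gt0.
- lra.
- lra.
- by move=> eta' eta'0; apply: filterS (mmtL g eta'0) => s /andP[].
- by apply: filterS (mmtL (g + e) k0) => s /andP[].
- by apply: filterS (mmtL (g - e) k0) => s /andP[].
Unshelve. all: by end_near. Qed.

Theorem gartner_ellis : L 0 = 0 ->
  satisfies_LDP (fun t A => Q [set w | A (Z t w / t)]) id (legendre L).
Proof.
move=> L0; split.
- move=> t t0; apply: is_borel_probability_image => O oO.
  by apply: measurable_scaled => //; exact: open_measurable.
- exact: cvg_id.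
- split; last exact: lsc_legendre.
  by move=> y; have := le_legendre L 0 y; rewrite mul0r L0 subr0.
- exact: gartner_ellis_lower.
- exact: gartner_ellis_upper.
Qed.

End gartner_ellis.

(** * The function Lambda *)

Section truncated_power.
Context (R : realType) (r : R).

(** For [r = 1 / nu] this is the growth rate of the exponential moments of [T t], and [Lambda_nu] is
    its composition with [Lambda]. *)
Definition truncated_power (x : R) : R := if 0 <= x then x `^ r else 0.

Lemma derivable_truncated_power (x : R) : 1 < r ->
  derivable truncated_power x 1.
Proof.
move=> r1; have r10 : 0 < r - 1 by rewrite subr_gt0.
have [x0|x0|->] := ltgtP x 0.
- apply: (@near_eq_derivable R R R (cst 0)); last exact: derivable_cst.
  near=> y; rewrite /truncated_power leNgt ifF//; apply/negbF.
  by near: y; exact: lt_nbhsl.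
- apply: (@near_eq_derivable R R R (fun x : R => x `^ r)); last first.
    by apply: derivable_powR; rewrite in_itv/= x0.
  near=> y; rewrite /truncated_power ifT//; apply: ltW.
  by near: y; exact: lt_nbhsr.
(* At [0] the difference quotient vanishes on the left and equals [h^(r - 1)] on the right, which is
   below [e] once [h < e^(1 / (r - 1))]. *)
apply/cvg_ex; exists 0 => /=; apply/cvgrPdist_lt => e e0.
have d0 : 0 < e `^ (r - 1)^-1 by rewrite powR_gt0.
near=> h; have h0 : h != 0 by near: h; exact: nbhs_dnbhs_neq.
rewrite sub0r normrN addr0 [_%:A]mulr1 /truncated_power lexx powR0; last first.
  by rewrite gt_eqF// (lt_trans _ r1).
rewrite subr0; case: ifPn => [h0'|_]; last by rewrite scaler0 normr0.
have hpos : 0 < h by rewrite lt0r h0.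
rewrite [_ *: _]mulrC -[h^-1]powR_inv1// -powRD ?h0 ?implybT//.
rewrite ger0_norm ?powR_ge0//.
rewrite (_ : e = (e `^ (r - 1)^-1) `^ (r - 1)); last first.
  by rewrite -powRrM mulVf ?gt_eqF// powRr1// ltW.
apply: gt0_ltr_powR => //; rewrite ?nnegrE ?ltW//.
rewrite -[ltLHS]gtr0_norm//.
by near: h; exact: dnbhs0_lt.
Unshelve. all: by end_near. Qed.

End truncated_power.

Section Lambda.
Context (R : realType) (a1 a2 b1 b2 : R).
Hypotheses (a1_gt0 : 0 < a1) (a2_gt0 : 0 < a2).
Hypotheses (b1_gt0 : 0 < b1) (b2_gt0 : 0 < b2).
Local Notation Lambda := (Lambda a1 a2 b1 b2).

(** Off-diagonal entries of the 2 x 2 matrix that the generator induces on the parity classes after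
    conjugation by [exp (g n)]. *)
Definition twisted_rate (u d g : R) : R := u * expR g + d * (expR g)^-1.

(** Discriminant of the characteristic polynomial of that matrix, whose diagonal is [- (a1 + a2)],
    [- (b1 + b2)]. *)
Definition Lambda_disc (g : R) : R :=
  (a1 + a2 - (b1 + b2)) ^+ 2 +
  4 * (twisted_rate b1 b2 g * twisted_rate a1 a2 g).

Lemma twisted_rate_gt0 u d g : 0 < u -> 0 < d -> 0 < twisted_rate u d g.
Proof. by move=> u0 d0; rewrite addr_gt0// mulr_gt0 ?invr_gt0 ?expR_gt0. Qed.

Lemma Lambda_disc_gt0 g : 0 < Lambda_disc g.
Proof.
by rewrite ltr_wpDl ?sqr_ge0// mulr_gt0// mulr_gt0// twisted_rate_gt0.
Qed.

Lemma LambdaE g :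
  Lambda g = 2^-1 * Num.sqrt (Lambda_disc g) - (a1 + a2 + b1 + b2) / 2.
Proof.
rewrite /Defs.Lambda; congr (_ - _); rewrite /h.
have z0 := expR_gt0 g; have zn : expR g != 0 by rewrite gt_eqF.
rewrite (_ : (_ - _) ^+ 2 * _ + _ = expR g ^+ 2 * Lambda_disc g); last first.
  by rewrite /Lambda_disc /twisted_rate; field.
by rewrite sqrtrM ?sqr_ge0// sqrtr_sqr gtr0_norm//; field.
Qed.

Lemma Lambda0 : Lambda 0 = 0.
Proof.
rewrite LambdaE (_ : Lambda_disc 0 = (a1 + a2 + b1 + b2) ^+ 2); last first.
  by rewrite /Lambda_disc /twisted_rate expR0 invr1; ring.
rewrite sqrtr_sqr ger0_norm; last by rewrite !addr_ge0// ltW.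
by rewrite mulrC subrr.
Qed.

Lemma Lambda_eigenvector g : exists v0 v1, [/\ 0 < v0, 0 < v1,
  twisted_rate a1 a2 g * v1 - (a1 + a2) * v0 = Lambda g * v0 &
  twisted_rate b1 b2 g * v0 - (b1 + b2) * v1 = Lambda g * v1].
Proof.
exists (twisted_rate a1 a2 g), (Lambda g + (a1 + a2)).
have A0 := twisted_rate_gt0 g a1_gt0 a2_gt0.
have B0 := twisted_rate_gt0 g b1_gt0 b2_gt0.
have s2 := sqr_sqrtr (ltW (Lambda_disc_gt0 g)).
(* Gives positivity of the second component, which is half of
   [sqrt disc + (a1 + a2 - (b1 + b2))]. *)
have sge : `|a1 + a2 - (b1 + b2)| < Num.sqrt (Lambda_disc g).
  rewrite -sqrtr_sqr ltr_sqrt ?Lambda_disc_gt0// /Lambda_disc.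
  by rewrite ltrDl mulr_gt0// mulr_gt0.
split => //.
- rewrite LambdaE; move: sge; rewrite ltr_norml; lra.
- ring.
- rewrite LambdaE; move: s2; set s := Num.sqrt _; rewrite /Lambda_disc => s2.
  set A := twisted_rate a1 a2 g in A0 s2 *.
  set B := twisted_rate b1 b2 g in B0 s2 *.
  have -> : B * A = (s ^+ 2 - (a1 + a2 - (b1 + b2)) ^+ 2) / 4.
    by rewrite s2; field.
  by field.
Qed.

Lemma derivable_scale (f : R -> R) (c g : R) : derivable f g 1 ->
  derivable (fun x => c * f x) g 1.
Proof. by move=> df; exact: (derivableM (derivable_cst c g 1) df). Qed.

Lemma derivable_twisted_rate (u d g : R) : derivable (twisted_rate u d) g 1.
Proof.
have dE : derivable (@expR R) g 1 by [].
have dV : derivable (fun x : R => (expR x)^-1) g 1.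
  by apply: derivableV; rewrite ?gt_eqF ?expR_gt0.
have -> : twisted_rate u d =
  (fun x => u * expR x) + (fun x => d * (expR x)^-1) by [].
by apply: derivableD; exact: derivable_scale.
Qed.

Lemma derivable_Lambda (g : R) : derivable Lambda g 1.
Proof.
have -> : Lambda = (fun g => 2^-1 * (Num.sqrt \o Lambda_disc) g) -
    cst ((a1 + a2 + b1 + b2) / 2).
  by apply/funext => x; exact: LambdaE.
have dT : derivable (twisted_rate b1 b2 * twisted_rate a1 a2) g 1.
  by apply: derivableM; exact: derivable_twisted_rate.
have dD : derivable Lambda_disc g 1.
  have -> : Lambda_disc = cst ((a1 + a2 - (b1 + b2)) ^+ 2) +
    (fun x => 4 * (twisted_rate b1 b2 * twisted_rate a1 a2) x) by [].
  apply: derivableD; first exact: derivable_cst.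
  exact: derivable_scale.
have dS : derivable (Num.sqrt \o Lambda_disc) g 1.
  apply/derivable1_diffP; apply: differentiable_comp.
    exact/derivable1_diffP.
  by apply/derivable1_diffP; have [] := is_derive1_sqrt (Lambda_disc_gt0 g).
by apply: derivableB; [exact: derivable_scale|exact: derivable_cst].
Qed.

Lemma twisted_rate_ge (u d g : R) : 0 < u -> 0 < d ->
  Num.min u d * expR `|g| <= twisted_rate u d g.
Proof.
move=> u0 d0; rewrite /twisted_rate; have [g0|g0] := leP 0 g.
  rewrite ger0_norm//; apply: ler_wpDr.
    by rewrite mulr_ge0 ?invr_ge0 ?expR_ge0// ltW.
  by rewrite ler_wpM2r ?expR_ge0// ge_min lexx.
rewrite -expRN ltr0_norm//; apply: ler_wpDl.
  by rewrite mulr_ge0 ?expR_ge0// ltW.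
by rewrite ler_wpM2r ?expR_ge0// ge_min lexx orbT.
Qed.

(** Dropping the square from the discriminant leaves the geometric mean of two twisted rates, each
    at least [c exp |g|]. *)
Lemma Lambda_expR_ge : exists c K, 0 < c /\
  forall g, c * expR `|g| - K <= Lambda g.
Proof.
exists (Num.min (Num.min a1 a2) (Num.min b1 b2)), ((a1 + a2 + b1 + b2) / 2).
set c := Num.min _ _; have c0 : 0 < c by rewrite !lt_min a1_gt0 a2_gt0 b1_gt0.
split=> // g; rewrite LambdaE lerD2r [leRHS]mulrC ler_pdivlMr//.
rewrite -[leLHS]ger0_norm ?mulr_ge0 ?expR_ge0 ?(ltW c0)//.
rewrite -sqrtr_sqr ler_wsqrtr// /Lambda_disc ler_wpDl ?sqr_ge0//.
rewrite (_ : (c * expR `|g| * 2) ^+ 2 =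
  4 * ((c * expR `|g|) * (c * expR `|g|))); last by ring.
have ce : 0 <= c * expR `|g| by rewrite mulr_ge0 ?expR_ge0 ?ltW.
rewrite ler_wpM2l//; apply: ler_pM => //.
  apply: le_trans (twisted_rate_ge g b1_gt0 b2_gt0).
  by rewrite ler_wpM2r ?expR_ge0// ge_min lexx orbT.
apply: le_trans (twisted_rate_ge g a1_gt0 a2_gt0).
by rewrite ler_wpM2r ?expR_ge0// ge_min lexx.
Qed.

Lemma superlinear_Lambda : superlinear Lambda.
Proof.
move=> M; have [c [K [c0 LK]]] := Lambda_expR_ge.
(* The constant comes from completing the square in [c |g|^2 / 2 - M |g|], after bounding [exp |g|]
   below by its quadratic term. *)
exists (K + M ^+ 2 / (2 * c)) => g; apply: le_trans (LK g).
have := @expR_ge1Dxn R `|g| 1 (normr_ge0 g).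
rewrite (_ : (2`!)%:R = 2 :> R)// => /(ler_wpM2l (ltW c0)).
have : 0 <= (c * `|g| - M) ^+ 2 / (2 * c).
  by rewrite divr_ge0 ?sqr_ge0// mulr_ge0// ltW.
rewrite (_ : (_ - _) ^+ 2 / _ =
  c * (`|g| ^+ 2 / 2) - M * `|g| + M ^+ 2 / (2 * c)).
  lra.
by field; rewrite gt_eqF.
Qed.

Variable nu : R.
Hypotheses (nu_gt0 : 0 < nu) (nu_lt1 : nu < 1).
Local Notation Lambda_nu := (Lambda_nu a1 a2 b1 b2 nu).

Lemma Lambda_nu0 : Lambda_nu 0 = 0.
Proof.
by rewrite /Defs.Lambda_nu Lambda0 lexx powR0// gt_eqF// divr_gt0.
Qed.

Lemma inv_nu_gt1 : 1 < 1 / nu.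
Proof. by rewrite ltr_pdivlMr// mul1r. Qed.

Lemma derivable_Lambda_nu (g : R) : derivable Lambda_nu g 1.
Proof.
rewrite (_ : Lambda_nu = truncated_power (1 / nu) \o Lambda)//.
apply/derivable1_diffP; apply: differentiable_comp.
  exact/derivable1_diffP/derivable_Lambda.
by apply/derivable1_diffP; apply: derivable_truncated_power; exact: inv_nu_gt1.
Qed.

Lemma superlinear_Lambda_nu : superlinear Lambda_nu.
Proof.
move=> M; have [C LC] := superlinear_Lambda M; exists (C + 1) => g.
(* A power above [1] lowers only the values in [[0, 1]], hence by at most [1]. *)
suff : Lambda g <= Lambda_nu g + 1 by have := LC g; lra.
rewrite /Defs.Lambda_nu; case: ifPn => [L0|]; last by rewrite -ltNge; lra.
have [L1|L1] := leP 1 (Lambda g); last first.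
  by rewrite (le_trans (ltW L1))// lerDr powR_ge0.
by rewrite (le_trans (le1r_powR L1 (ltW inv_nu_gt1)))// lerDl.
Qed.

End Lambda.

(** * Birth and death chains *)

Section esum_seq.
Context (R : realType) (T : choiceType) (a : T -> \bar R).
Local Open Scope ereal_scope.

Lemma le_seq_esum (s : seq T) : uniq s ->
  \sum_(x <- s) a x <= \esum_(x in [set: T]) a x.
Proof.
move=> us; apply: esum_ge; exists [set` s].
  by split => //; exact: finite_seq.
by rewrite fsbig_seq.
Qed.

Lemma esum_le_seq (c : \bar R) :
  (forall s, uniq s -> \sum_(x <- s) a x <= c) ->
  \esum_(x in [set: T]) a x <= c.
Proof.
move=> sc; apply: ge_ereal_sup => _ [A [finA _] <-].
by rewrite fsbig_finite//; apply: sc; exact: finmap.fset_uniq.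
Qed.

End esum_seq.

Section birth_death.
Context (R : realType) (p : int -> int -> R -> R) (qu qd : int -> R) (q : R).

(** Laid out like [alternating_generator], which is an instance of it by conversion. *)
Definition birth_death_generator (k n : int) : R :=
  if n == k + 1 then qu k
  else if n == k - 1 then qd k
  else if n == k then - (qu k + qd k)
  else 0.

Definition birth_death_drift (f : int -> R) (k : int) : R :=
  qu k * (f (k + 1) - f k) + qd k * (f (k - 1) - f k).

Hypothesis p_trans : transition_function p.
Hypothesis p_gen : has_generator p birth_death_generator.
Hypotheses (qu_ge0 : forall k, 0 <= qu k) (qd_ge0 : forall k, 0 <= qd k).
Hypothesis rate_le : forall k, qu k + qd k <= q.

Let p_ge0 k n t : 0 <= t -> 0 <= p k n t.
Proof. by move=> t0; case: p_trans => + _ _ _; exact. Qed.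

Lemma sum_transition_le1 k t (s : seq int) : 0 <= t -> uniq s ->
  \sum_(n <- s) p k n t <= 1.
Proof.
move=> t0 us; rewrite -lee_fin -sumEFin; case: p_trans => _ /(_ k t t0) <- _ _.
exact: le_seq_esum.
Qed.

Lemma transition_le1 k n t : 0 <= t -> p k n t <= 1.
Proof.
move=> t0; have := @sum_transition_le1 k t [:: n] t0 isT.
by rewrite big_seq1.
Qed.

Lemma chapman_kolmogorov_ge k n t r (s : seq int) :
  0 <= t -> 0 <= r -> uniq s ->
  \sum_(l <- s) p k l t * p l n r <= p k n (t + r).
Proof.
move=> t0 r0 us; rewrite -lee_fin -sumEFin; case: p_trans => _ _ _ ->//.
exact: le_seq_esum.
Qed.

(* Apply the lower bound to the complementary probabilities [1 - p l n r]. *)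
Lemma chapman_kolmogorov_le k n t r (s : seq int) :
  0 <= t -> 0 <= r -> uniq s ->
  p k n (t + r) <= 1 - \sum_(l <- s) p k l t + \sum_(l <- s) p k l t * p l n r.
Proof.
move=> t0 r0 us.
have : ((p k n (t + r))%:E +
    \esum_(l in [set: int]) (p k l t * (1 - p l n r))%:E = 1)%E.
  case: p_trans => _ /(_ k t t0) <- _ ->//; rewrite -esumD.
  - apply: eq_esum => l _; rewrite -EFinD; congr EFin; ring.
  - by move=> l _; rewrite lee_fin mulr_ge0 ?p_ge0.
  - by move=> l _; rewrite lee_fin mulr_ge0 ?p_ge0// subr_ge0 transition_le1.
move=> E1.
have : (\sum_(l <- s) (p k l t * (1 - p l n r))%:E <= 1 - (p k n (t + r))%:E)%E.
  by rewrite leeBrDr// -E1 addeC leeD2l//; exact: le_seq_esum.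
rewrite sumEFin -EFinB lee_fin.
under eq_bigr do rewrite mulrBr mulr1.
rewrite sumrB; lra.
Qed.

Lemma generator_expansion k n (e : R) : 0 < e -> exists2 delta, 0 < delta &
  forall r, 0 < r < delta ->
  `|p k n r - (k == n)%:R - r * birth_death_generator k n| <= e * r.
Proof.
move=> e0; have /cvgrPdist_lt/(_ _ e0) := @p_gen k n.
move=> [delta /= d0 dP]; exists delta => // r /andP[r0 rd].
have := dP r; rewrite /= sub0r normrN gtr0_norm// => /(_ rd r0).
case: p_trans => _ _ -> _ h.
rewrite -[X in X - _ - _](subrK (k == n)%:R) addrK.
rewrite -[p k n r - _](mulfVK (lt0r_neq0 r0)) [r * _]mulrC -mulrBl normrM.
by rewrite (gtr0_norm r0) ler_wpM2r ?(ltW r0)// distrC ltW.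
Qed.

(** The backward equation as an Euler step, with [delta] uniform in [t] and [n]. Only the
    intermediate states [k], [k + 1], [k - 1] are kept. The mass of the others is [o(r)] because the
    row of the generator sums to [0]; three errors in that mass and three in the kept terms give
    [e / 6]. *)
Lemma transition_one_step k (e : R) : 0 < e -> exists2 delta, 0 < delta &
  forall r t n, 0 < r < delta -> 0 <= t ->
  `|p k n (t + r) - p k n t - r * birth_death_drift (fun l => p l n t) k| <=
  e * r.
Proof.
move=> e0; have e60 : 0 < e / 6 by rewrite divr_gt0.
have [d1 d10 H1] := generator_expansion k k e60.
have [d2 d20 H2] := generator_expansion k (k + 1) e60.
have [d3 d30 H3] := generator_expansion k (k - 1) e60.
exists (Num.min d1 (Num.min d2 d3)); first by rewrite !lt_min d10 d20 d30.
move=> r t n /andP[r0]; rewrite !lt_min => /and3P[rd1 rd2 rd3] t0.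
have {H1} := H1 r; rewrite r0 rd1 => /(_ isT).
have {H2} := H2 r; rewrite r0 rd2 => /(_ isT).
have {H3} := H3 r; rewrite r0 rd3 => /(_ isT).
have k1 : (k + 1 == k - 1) = false by lia.
have k2 : (k == k + 1) = false by lia.
have k3 : (k == k - 1) = false by lia.
have k4 : (k - 1 == k + 1) = false by lia.
rewrite /birth_death_generator !eqxx ?k1 ?k2 ?k3 ?k4 /= mulr0n mulr1n !subr0.
have us : uniq [:: k; k + 1; k - 1] by rewrite /= !inE k2 k3 k1.
have lo := chapman_kolmogorov_ge k n (ltW r0) t0 us.
have up := chapman_kolmogorov_le k n (ltW r0) t0 us.
move: lo up; rewrite !big_cons !big_nil !addr0 /birth_death_drift [t + r]addrC.
set P := p k n (r + t).
have := p_ge0 k n t0; have := transition_le1 k n t0.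
have := p_ge0 (k + 1) n t0; have := transition_le1 (k + 1) n t0.
have := p_ge0 (k - 1) n t0; have := transition_le1 (k - 1) n t0.
move: (p k n t) (p (k + 1) n t) (p (k - 1) n t) => x y z z1 z0 y1 y0 x1 x0.
move: (p k k r) (p k (k + 1) r) (p k (k - 1) r) => X Y V lo up.
have D := qd_ge0 k; have U := qu_ge0 k.
move=> HV HY HX.
set a := V - r * qd k in HV; set b := Y - r * qu k in HY.
set c := X - 1 - r * - (qu k + qd k) in HX.
have xa (w m : R) : 0 <= w -> w <= 1 ->
    `|m| <= e / 6 * r -> `|m * w| <= e / 6 * r.
  move=> w0 w1 hm; rewrite normrM (ger0_norm w0); apply: le_trans hm.
  by rewrite ler_piMr.
have Ez := xa z a z0 z1 HV; have Ey := xa y b y0 y1 HY.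
have Ex := xa x c x0 x1 HX.
have EX : X * x + (Y * y + V * z) = x + r * (qu k * (y - x) + qd k * (z - x)) +
    (c * x + (b * y + a * z)) by rewrite /a /b /c; ring.
have E1 : 1 - (X + (Y + V)) = - (a + b + c) by rewrite /a /b /c; ring.
rewrite EX in lo up; rewrite E1 in up.
move: Ex Ey Ez HX HY HV.
rewrite !ler_norml => /andP[? ?] /andP[? ?] /andP[? ?].
move=> /andP[? ?] /andP[? ?] /andP[? ?].
apply/andP; split; lra.
Qed.

End birth_death.

(** * A maximum principle for Euler subsolutions *)

Section maximum_principle.
Context (R : realType) (qu qd : int -> R) (q : R).
Hypotheses (qu_ge0 : forall k, 0 <= qu k) (qd_ge0 : forall k, 0 <= qd k).
Hypothesis rate_le : forall k, qu k + qd k <= q.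
Implicit Types (W : int -> R -> R) (a b : R).
Local Notation drift := (birth_death_drift qu qd).

(* Forward Euler form of [d/ds (W k s) <= drift (W s) k].  The mesh [delta] may
   depend on [k], as the generator is only given state by state. *)
Definition subsolution W a b := forall k (e : R), 0 < e ->
  exists2 delta, 0 < delta &
  forall r s, 0 < r < delta -> a <= s -> s + r <= b ->
  W k (s + r) <= W k s + r * drift (W ^~ s) k + e * r.

(* Euler steps of mesh [r] give [W k (a + i r) <= i r (q B + e / D)]. *)
Lemma subsolution_halve_bound W a b (B : R) : subsolution W a b -> 0 <= B ->
  q * (b - a) <= 2^-1 ->
  (forall k, W k a <= 0) ->
  (forall k s, a <= s <= b -> W k s <= B) ->
  forall k s, a <= s <= b -> W k s <= B / 2.
Proof.
move=> sW B0 qab Wa WB k s /andP[as_ sb].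
have q0 : 0 <= q by rewrite (le_trans _ (rate_le 0))// addr_ge0.
have [->|sa] := eqVneq s a; first by rewrite (le_trans (Wa k))// divr_ge0.
have D0 : 0 < s - a by rewrite subr_gt0 lt_neqAle eq_sym sa.
set D := s - a in D0.
apply/ler_addgt0Pr => e e0.
have eD0 : 0 < e / D by rewrite divr_gt0.
have [delta d0 step] := sW k _ eD0.
pose n := (Num.truncn (D / delta)).+1.
have n0 : 0 < n%:R :> R by rewrite ltr0n.
pose r := D / n%:R.
have r0 : 0 < r by rewrite divr_gt0.
have rd : r < delta.
  by rewrite /r ltr_pdivrMr// mulrC -ltr_pdivrMr// truncnS_gt.
have Dr : D = n%:R * r by rewrite /r mulrCA divff ?mulr1// gt_eqF.
have qr : q * r <= 2^-1.
  apply: le_trans qab; rewrite ler_wpM2l//.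
  apply: (@le_trans _ _ D); last by rewrite lerB.
  by rewrite Dr; apply: ler_peMl; [exact: ltW|rewrite ler1n].
have main i : (i <= n)%N -> W k (a + i%:R * r) <= i%:R * r * (q * B + e / D).
  elim: i => [|i IH] iln; first by rewrite !mul0r addr0.
  have in_ : (i <= n)%N by exact: ltnW.
  have ir : i%:R * r + r <= D.
    rewrite Dr -[X in _ + X]mul1r -mulrDl natr1.
    by rewrite ler_wpM2r ?(ltW r0)// ler_nat.
  have ir0 : 0 <= i%:R * r by rewrite mulr_ge0 ?(ltW r0).
  set t := a + i%:R * r in IH *.
  have ti : a <= t <= b by rewrite /t /D in ir *; lra.
  have -> : a + i.+1%:R * r = t + r by rewrite /t -natr1; ring.
  have := step r t; rewrite r0 rd => /(_ isT).
  have /andP[-> _] := ti => /(_ isT).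
  have -> : t + r <= b by rewrite /t /D in ir *; lra.
  move=> /(_ isT) /le_trans; apply.
  have {}IH := IH in_.
  rewrite /birth_death_drift.
  have h1 := ler_wpM2l (qu_ge0 k) (WB (k + 1) _ ti).
  have h2 := ler_wpM2l (qd_ge0 k) (WB (k - 1) _ ti).
  set w := W k t in IH *.
  apply: (@le_trans _ _ (w + r * ((qu k + qd k) * (B - w)) + e / D * r)).
    rewrite lerD2r lerD2l ler_wpM2l ?(ltW r0)//; lra.
  have h3 : (qu k + qd k) * B <= q * B by rewrite ler_wpM2r.
  (* The coefficient of [w] in the Euler step; its sign lets the induction hypothesis be
     substituted. *)
  have h4 : 0 <= 1 - r * (qu k + qd k).
    rewrite subr_ge0 mulrC; apply: (@le_trans _ _ (q * r)).
      by rewrite ler_wpM2r ?(ltW r0).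
    by apply: le_trans qr _; lra.
  have h5 := ler_wpM2l h4 IH.
  have h6 := ler_wpM2l (ltW r0) h3.
  have h7 : 0 <= i%:R * r * (q * B + e / D).
    by rewrite mulr_ge0// addr_ge0 ?(ltW eD0)// mulr_ge0.
  have h8 : 0 <= r * (qu k + qd k) by rewrite mulr_ge0 ?addr_ge0// ltW.
  have h9 := mulr_ge0 h8 h7.
  have -> : i.+1%:R = i%:R + 1 :> R by rewrite natr1.
  lra.
have := main n (leqnn n); rewrite -Dr [a + D]addrC subrK => /le_trans; apply.
rewrite mulrDr [D * (e / D)]mulrC divfK ?gt_eqF// lerD2r mulrA.
rewrite [leRHS]mulrC ler_wpM2r// (le_trans _ qab)// mulrC ler_wpM2l// lerB//.
Qed.

(** The halving bound feeds on its own conclusion, which gives [|B| / 2 ^ j] for every [j]. *)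
Lemma subsolution_short_le0 W a b (B : R) : subsolution W a b ->
  q * (b - a) <= 2^-1 ->
  (forall k, W k a <= 0) ->
  (forall k s, a <= s <= b -> W k s <= B) ->
  forall k s, a <= s <= b -> W k s <= 0.
Proof.
move=> sW qab Wa WB.
have main j : forall k s, a <= s <= b -> W k s <= `|B| / 2 ^+ j.
  elim: j => [|j IH].
    by move=> k s sab; rewrite expr0 divr1 (le_trans (WB k s sab))// ler_norm.
  by rewrite exprSr invfM mulrA; apply: subsolution_halve_bound => //.
move=> k s sab; rewrite leNgt; apply/negP => W0.
pose j := (Num.truncn (`|B| / W k s)).+1.
have := main j k s sab; rewrite leNgt => /negP; apply.
rewrite ltr_pdivrMr ?exprn_gt0// mulrC -ltr_pdivrMr//.
apply: lt_le_trans (truncnS_gt _) _.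
by rewrite -natrX ler_nat ltnW// ltn_expl.
Qed.

(** Steps of length [t0 = 1 / (2 (q + 1))] are short enough for [subsolution_short_le0], and
    nonpositivity at the end of one is the initial condition of the next. The bound [B], uniform in
    the state, makes up for the lack of compactness of the state space. *)
Lemma maximum_principle W (b B : R) : subsolution W 0 b ->
  (forall k, W k 0 <= 0) ->
  (forall k s, 0 <= s <= b -> W k s <= B) ->
  forall k s, 0 <= s <= b -> W k s <= 0.
Proof.
move=> sW W0 WB.
have q0 : 0 <= q by rewrite (le_trans _ (rate_le 0))// addr_ge0.
have q10 : 0 < q + 1 by rewrite ltr_wpDl.
pose t0 := (2 * (q + 1))^-1.
have t00 : 0 < t0 by rewrite invr_gt0 mulr_gt0.
have main (j : nat) : forall k s, 0 <= s <= b -> s <= j%:R * t0 -> W k s <= 0.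
  elim: j => [|j IH] k s /andP[s0 sb] sj.
    suff -> : s = 0 by [].
    by apply/le_anti; rewrite s0 andbT (le_trans sj)// mul0r.
  have [sj'|sj'] := leP s (j%:R * t0); first by apply: IH => //; rewrite s0.
  have j0 : 0 <= j%:R * t0 by rewrite mulr_ge0 ?(ltW t00).
  apply: (@subsolution_short_le0 W (j%:R * t0) s B).
  - move=> k' e e0; have [delta d0 H] := sW k' e e0.
    exists delta => // r t rd at_ tb.
    by apply: H => //; [exact: le_trans at_|exact: le_trans sb].
  - apply: (@le_trans _ _ (q * t0)).
      by rewrite ler_wpM2l// lerBlDr (le_trans sj)// -natr1 mulrDl mul1r addrC.
    rewrite /t0 invfM mulrCA ger_pMr ?invr_gt0// ler_pdivrMr//; lra.
  - by move=> k'; apply: IH => //; rewrite j0/= (le_trans (ltW sj') sb).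
  - move=> k' t /andP[jt ts]; apply: WB.
    by rewrite (le_trans j0)//= (le_trans ts).
  - by rewrite lexx andbT ltW.
move=> k s sb; apply: (main (Num.truncn (s / t0)).+1) => //.
by rewrite -ler_pdivrMr// ltW// truncnS_gt.
Qed.

End maximum_principle.

(** * Means of eigenfunctions under a birth-death chain *)

Section exponential_functionals.
Context (R : realType) (p : int -> int -> R -> R) (qu qd : int -> R) (q : R).
Hypothesis p_trans : transition_function p.
Hypothesis p_gen : has_generator p (birth_death_generator qu qd).
Hypotheses (qu_ge0 : forall k, 0 <= qu k) (qd_ge0 : forall k, 0 <= qd k).
Hypothesis rate_le : forall k, qu k + qd k <= q.
Local Notation drift := (birth_death_drift qu qd).

Let p_ge0 k n t : 0 <= t -> 0 <= p k n t.
Proof. by move=> t0; case: p_trans => + _ _ _; exact. Qed.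

(** A truncated mean of [u]. The one-step error is the same for every target state, so it can be
    summed against [u] over finite sets only. *)
Definition partial_mean (u : int -> R) (s : seq int) (k : int) (t : R) :=
  \sum_(n <- s) p k n t * u n.

Lemma drift_sum (I : Type) (s : seq I) (F : I -> int -> R) (c : I -> R) k :
  drift (fun l => \sum_(i <- s) F i l * c i) k =
  \sum_(i <- s) drift (F i) k * c i.
Proof.
rewrite /birth_death_drift -!sumrB !mulr_sumr -big_split/=.
by apply: eq_bigr => i _; ring.
Qed.

Lemma partial_mean_one_step u s k (e : R) : 0 < e ->
  exists2 delta, 0 < delta & forall r t, 0 < r < delta -> 0 <= t ->
  `|partial_mean u s k (t + r) - partial_mean u s k t -
    r * drift (partial_mean u s ^~ t) k| <= e * r.
Proof.
move=> e0; pose M := 1 + \sum_(n <- s) `|u n|.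
have M0 : 0 < M by rewrite ltr_pwDl// sumr_ge0.
have eM0 : 0 < e / M by rewrite divr_gt0.
have [delta d0 H] := transition_one_step p_trans p_gen qu_ge0 qd_ge0 k eM0.
exists delta => // r t rd t0; rewrite drift_sum /partial_mean mulr_sumr -!sumrB.
rewrite (eq_bigr (fun n => (p k n (t + r) - p k n t -
    r * drift (fun l => p l n t) k) * u n)); last by move=> n _; ring.
have r0 : 0 < r by case/andP: rd.
apply: (le_trans (ler_norm_sum _ _ _)).
apply: (@le_trans _ _ (\sum_(n <- s) (e / M * r) * `|u n|)).
  by apply: ler_sum => n _; rewrite normrM ler_wpM2r// H.
rewrite -mulr_sumr mulrAC ler_wpM2r ?(ltW r0)//.
rewrite mulrAC ler_pdivrMr// ler_wpM2l ?(ltW e0)// /M; lra.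
Qed.

Lemma partial_mean0 u s k : uniq s ->
  partial_mean u s k 0 = if k \in s then u k else 0.
Proof.
move=> us; rewrite /partial_mean; case: p_trans => _ _ p0 _.
under eq_bigr do rewrite p0.
case: ifPn => ks.
  rewrite (bigD1_seq k)//= eqxx mul1r big1_seq ?addr0// => n /andP[nk _].
  by rewrite eq_sym (negbTE nk) mul0r.
rewrite big1_seq// => n /andP[_ ns].
case: eqVneq => [kn|]; last by rewrite mul0r.
by rewrite kn ns in ks.
Qed.

Lemma partial_mean_le_sum u s k t : (forall n, 0 <= u n) -> 0 <= t ->
  partial_mean u s k t <= \sum_(n <- s) u n.
Proof.
move=> u0 t0; apply: ler_sum => n _; rewrite ler_piMl//.
exact: (transition_le1 p_trans).
Qed.

Variables (u : int -> R) (L : R).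
Hypothesis u_gt0 : forall k, 0 < u k.
Hypothesis u_eigen : forall k, drift u k = L * u k.

Let E k t := expR (L * t) * u k.

Let drift_E t k : drift (E ^~ t) k = L * E k t.
Proof. rewrite /E mulrCA -u_eigen /birth_death_drift; ring. Qed.

Let E_ge k t r : E k t + r * drift (E ^~ t) k <= E k (t + r).
Proof.
rewrite drift_E /E mulrDr expRD.
have := ler_wpM2l (mulr_ge0 (expR_ge0 (L * t)) (ltW (u_gt0 k)))
  (expR_ge1Dx (L * r)).
lra.
Qed.

(** A truncated mean starts from [u k] or [0] and stays below the finite sum of [u] over [s],
    whatever [k] is; so it can be compared with the exact solution [E]. *)
Lemma partial_mean_le s k t : uniq s -> 0 <= t ->
  partial_mean u s k t <= expR (L * t) * u k.
Proof.
move=> us t0; rewrite -subr_le0 -/(E k t).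
apply: (@maximum_principle _ _ _ _ qu_ge0 qd_ge0 rate_le
  (fun k t => partial_mean u s k t - E k t) t (\sum_(n <- s) u n)); last first.
- by rewrite t0 lexx.
- move=> {}k r /andP[r0 _]; rewrite lerBlDr; apply: ler_wpDr.
    by rewrite mulr_ge0 ?expR_ge0// ltW.
  by apply: partial_mean_le_sum => // n; exact: ltW.
- move=> {}k; rewrite partial_mean0// /E mulr0 expR0 mul1r.
  by case: ifP => _; rewrite ?subrr// sub0r oppr_le0 ltW.
move=> {}k e e0; have [delta d0 H] := partial_mean_one_step u s k e0.
exists delta => // r t' rd t'0 _; have := H r t' rd t'0; have := E_ge k t' r.
have -> : drift (fun l => partial_mean u s l t' - E l t') k =
  drift (partial_mean u s ^~ t') k - drift (E ^~ t') k.
  by rewrite /birth_death_drift; ring.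
by rewrite ler_norml => + /andP[]; lra.
Qed.

Definition int_ball (m : nat) : seq int :=
  [seq i%:Z - m%:Z | i <- iota 0 (m.*2).+1].

Lemma int_ball_uniq m : uniq (int_ball m).
Proof. by rewrite map_inj_uniq ?iota_uniq// => i j; lia. Qed.

Lemma mem_int_ball m (k : int) : (`|k| <= m)%N -> k \in int_ball m.
Proof.
move=> km; apply/mapP; exists `|(k + m%:Z)%R|%N; last by lia.
by rewrite mem_iota; lia.
Qed.

Variable theta C : R.
Hypotheses (theta_ge0 : 0 <= theta).
Hypothesis u_growth : forall k, u k <= C * expR (theta * `|k|%N%:R).

(** A Lyapunov function: one jump multiplies it by at most [exp (theta + 1)], whence the rate [K] in
    [drift_rho]. *)
Let rho (k : int) := expR ((theta + 1) * `|k|%N%:R).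
Let K := q * (expR (theta + 1) - 1).

Let q_ge0 : 0 <= q.
Proof. by rewrite (le_trans _ (rate_le 0))// addr_ge0. Qed.

Let K_ge0 : 0 <= K.
Proof. by rewrite mulr_ge0// subr_ge0 -[leLHS]expR0 ler_expR addr_ge0. Qed.

Let drift_rho k : drift rho k <= K * rho k.
Proof.
have rho0 : 0 <= rho k by exact: expR_ge0.
have t10 : 0 <= theta + 1 by rewrite addr_ge0.
have near_ l : (`|l| <= `|k| + 1)%N ->
    rho l - rho k <= (expR (theta + 1) - 1) * rho k.
  move=> lk; rewrite mulrBl mul1r lerD2r /rho -expRD ler_expR.
  apply: (@le_trans _ _ ((theta + 1) * (`|k| + 1)%N%:R)).
    by rewrite ler_wpM2l// ler_nat.
  by rewrite natrD mulrDr mulr1 addrC.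
have h1 : (`|(k + 1)%R| <= `|k| + 1)%N by lia.
have h2 : (`|(k - 1)%R| <= `|k| + 1)%N by lia.
have h3 := ler_wpM2l (qu_ge0 k) (near_ _ h1).
have h4 := ler_wpM2l (qd_ge0 k) (near_ _ h2).
rewrite /birth_death_drift; apply: le_trans (lerD h3 h4) _.
rewrite -mulrDl /K -mulrA ler_wpM2r// mulr_ge0//.
by rewrite subr_ge0 -[leLHS]expR0 ler_expR.
Qed.

Let C_gt0 : 0 < C.
Proof.
by have := lt_le_trans (u_gt0 0) (u_growth 0); rewrite pmulr_lgt0 ?expR_gt0.
Qed.

(** In the comparison from below [E] enters with a plus sign, and [exp (L r)] has to be bounded
    above to second order; the bound follows from [exp x <= 1 / (1 - x)]. *)
Let expR_le_quadratic (x : R) : x <= 2^-1 -> expR x <= 1 + x + 2 * x ^+ 2.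
Proof.
move=> x2; have x10 : 0 < 1 - x by lra.
apply: (@le_trans _ _ (1 - x)^-1).
  rewrite -[leLHS]invrK lef_pV2 ?posrE ?invr_gt0 ?expR_gt0//.
  by rewrite -expRN expR_ge1Dx.
rewrite -div1r ler_pdivrMr// -subr_ge0.
rewrite (_ : _ - 1 = x ^+ 2 * (1 - 2 * x)); last by ring.
by rewrite mulr_ge0 ?sqr_ge0//; lra.
Qed.

(* Since [rho] dominates [u] at infinity, [E - e * exp (K t) rho] is bounded
   above, and it is nonpositive at time 0 off a finite set. *)
Lemma partial_mean_ge (e : R) k t : 0 < e -> 0 <= t -> exists2 s, uniq s &
  expR (L * t) * u k <= partial_mean u s k t + e * (expR (K * t) * rho k).
Proof.
move=> e0 t0; pose A := expR (`|L| * t).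
have A1 : 1 <= A by rewrite -[leLHS]expR0 ler_expR mulr_ge0.
have A0 : 0 < A by exact: expR_gt0.
have rho0 l : 0 < rho l by exact: expR_gt0.
(* Off the ball of radius [m] the extra factor [exp |l|] of [rho l] exceeds [C A / e], where [A]
   bounds [exp (L r)] for all [r] in [[0, t]]. *)
pose m := (Num.truncn (e^-1 * (C * A))).+1.
have u_far l : (m < `|l|)%N -> A * u l <= e * rho l.
  move=> ml; apply: (@le_trans _ _ (A * (C * expR (theta * `|l|%N%:R)))).
    by rewrite ler_wpM2l// ltW.
  rewrite /rho mulrDl mul1r expRD mulrCA mulrA mulrC [leRHS]mulrCA.
  rewrite ler_wpM2l ?expR_ge0//.
  rewrite -ler_pdivrMl//.
  apply: le_trans (ltW (truncnS_gt _)) _; rewrite -/m.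
  apply: (@le_trans _ _ `|l|%N%:R); first by rewrite ler_nat; exact: ltnW.
  by apply: le_trans (expR_ge1Dx _); rewrite lerDr.
exists (int_ball m); first exact: int_ball_uniq.
rewrite -/(E k t) -lerBlDl -subr_le0.
apply: (@maximum_principle _ _ _ _ qu_ge0 qd_ge0 rate_le
  (fun l r => E l r - partial_mean u (int_ball m) l r -
    e * (expR (K * r) * rho l))
  t (A * (C * expR (theta * m%:R)))); last first.
- by rewrite t0 lexx.
- move=> l r /andP[r0 rt].
  have pm0 : 0 <= partial_mean u (int_ball m) l r.
    by apply: sumr_ge0 => n _; rewrite mulr_ge0 ?p_ge0// ltW.
  have EA : E l r <= A * u l.
    rewrite /E ler_wpM2r ?(ltW (u_gt0 l))// ler_expR.
    by apply: le_trans (ler_wpM2r r0 (ler_norm L)) _; rewrite ler_wpM2l.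
  have rK : e * rho l <= e * (expR (K * r) * rho l).
    rewrite ler_wpM2l ?(ltW e0)// ler_peMl ?(ltW (rho0 l))//.
    by rewrite -[leLHS]expR0 ler_expR mulr_ge0.
  have [lm|ml] := leqP `|l|%N m; last first.
    have := u_far _ ml; have : 0 <= A * (C * expR (theta * m%:R)).
      by rewrite !mulr_ge0 ?expR_ge0// ltW.
    lra.
  have : A * u l <= A * (C * expR (theta * m%:R)).
    rewrite ler_wpM2l ?(ltW A0)//; apply: le_trans (u_growth l) _.
    by rewrite ler_wpM2l ?(ltW C_gt0)// ler_expR ler_wpM2l// ler_nat.
  have : 0 < e * rho l by rewrite mulr_gt0.
  lra.
- move=> l; rewrite partial_mean0 ?int_ball_uniq// /E !mulr0 expR0 !mul1r.
  have er0 : 0 < e * rho l by rewrite mulr_gt0.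
  case: ifPn => ls; first by lra.
  have ml : (m < `|l|)%N.
    by rewrite ltnNge; apply: contra ls; exact: mem_int_ball.
  have := u_far _ ml; have : u l <= A * u l by rewrite ler_peMl// ltW.
  lra.
move=> l e' e'0.
have e'20 : 0 < e' / 2 by rewrite divr_gt0.
have [d1 d10 H] := partial_mean_one_step u (int_ball m) l e'20.
pose Q := A * u l * (2 * L ^+ 2) + 1.
have Au0 : 0 <= A * u l by rewrite mulr_ge0 ?(ltW A0) ?(ltW (u_gt0 l)).
have Q0 : 0 < Q by rewrite ltr_wpDl// mulr_ge0// mulr_ge0 ?sqr_ge0.
have L10 : 0 < 2 * (`|L| + 1) by rewrite mulr_gt0// ltr_wpDl.
(* The three bounds control the error of the truncated mean, give [L r <= 1 / 2] for
   [expR_le_quadratic], and make the second-order term at most [e' / 2 * r]. *)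
exists (Num.min d1 (Num.min (2 * (`|L| + 1))^-1 (e' / 2 / Q))).
  by rewrite !lt_min d10 invr_gt0 L10 divr_gt0.
move=> r s /andP[r0]; rewrite !lt_min => /and3P[rd1 rL rQ] s0 st.
have /= := H r s; rewrite r0 rd1 => /(_ isT s0).
rewrite ler_norml => /andP[Hlo _].
have EU : E l (s + r) <= E l s + r * drift (E ^~ s) l + e' / 2 * r.
  have El : E l s <= A * u l.
    rewrite /E ler_wpM2r ?(ltW (u_gt0 l))// ler_expR.
    apply: le_trans (ler_wpM2r s0 (ler_norm L)) _; rewrite ler_wpM2l//.
    by apply: le_trans st; rewrite lerDl ltW.
  have Lr : L * r <= 2^-1.
    apply: (@le_trans _ _ ((`|L| + 1) * (2 * (`|L| + 1))^-1)).
      apply: le_trans (ler_wpM2r (ltW r0) (ler_norm L)) _.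
      by apply: ler_pM; rewrite ?normr_ge0 ?lerDl// ltW.
    by rewrite invfM mulrCA divff ?mulr1// gt_eqF// ltr_wpDl.
  have E0 : 0 <= E l s by rewrite mulr_ge0 ?expR_ge0 ?ltW.
  rewrite drift_E {1}/E mulrDr expRD mulrAC -/(E l s).
  have h1 := ler_wpM2l E0 (expR_le_quadratic Lr).
  have h2 : E l s * (2 * (L * r) ^+ 2) <= e' / 2 * r.
    apply: (@le_trans _ _ (A * u l * (2 * (L * r) ^+ 2))).
      by rewrite ler_wpM2r// mulr_ge0 ?sqr_ge0.
    rewrite exprMn [r ^+ 2]expr2 !mulrA ler_wpM2r ?(ltW r0)//.
    apply: (@le_trans _ _ (r * Q)); first by rewrite /Q; lra.
    by rewrite -ler_pdivlMr// ltW.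
  lra.
have RL : e * (expR (K * s) * rho l) +
      r * drift (fun l => e * (expR (K * s) * rho l)) l
    <= e * (expR (K * (s + r)) * rho l).
  have -> : drift (fun l => e * (expR (K * s) * rho l)) l =
      e * (expR (K * s) * drift rho l) by rewrite /birth_death_drift; ring.
  rewrite [r * _]mulrCA -mulrDr ler_wpM2l ?(ltW e0)// [r * _]mulrCA -mulrDr.
  rewrite [K * (s + r)]mulrDr expRD -mulrA ler_wpM2l ?expR_ge0//.
  have h1 := ler_wpM2l (ltW r0) (drift_rho l).
  have h2 := ler_wpM2r (ltW (rho0 l)) (expR_ge1Dx (K * r)).
  lra.
have -> : drift ((fun l r => E l r - partial_mean u (int_ball m) l r -
    e * (expR (K * r) * rho l)) ^~ s) l =
  drift (E ^~ s) l - drift (partial_mean u (int_ball m) ^~ s) l -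
  drift (fun l => e * (expR (K * s) * rho l)) l.
  by rewrite /birth_death_drift; ring.
lra.
Qed.

Theorem transition_exponential_mean k t : 0 <= t ->
  (\esum_(n in [set: int]) (p k n t * u n)%:E = (expR (L * t) * u k)%:E)%E.
Proof.
move=> t0; apply/eqP; rewrite eq_le; apply/andP; split.
  apply: esum_le_seq => s us; rewrite sumEFin lee_fin.
  exact: partial_mean_le.
apply/lee_addgt0Pr => e e0.
pose B := expR (K * t) * rho k.
have B0 : 0 < B by rewrite mulr_gt0 ?expR_gt0.
have [s us sP] := @partial_mean_ge (e / B) k t (divr_gt0 e0 B0) t0.
apply: (@le_trans _ _ (partial_mean u s k t + e)%:E).
  by rewrite lee_fin (le_trans sP)// lerD2l divfK// gt_eqF.
rewrite EFinD leeD2r// /partial_mean -sumEFin; exact: le_seq_esum.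
Qed.

End exponential_functionals.

(** * The inverse stable subordinator *)

Section inverse_subordinator.
Context (R : realType) d (W : measurableType d) (P : probability W R).
Variables (nu : R) (S : R -> W -> R).
Hypotheses (nu_gt0 : 0 < nu) (nu_lt1 : nu < 1).
Hypothesis S_stable : stable_subordinator P nu S.
Local Notation T := (inverse_process S).

Let mS t : 0 <= t -> measurable_fun [set: W] (S t).
Proof. by case: S_stable => + _ _ _ _; exact. Qed.

Let S_mono s t w : 0 <= s -> s <= t -> S s w <= S t w.
Proof. by move=> s0 st; case: S_stable => _ /(_ w)[_ + _] _ _ _; exact. Qed.

Lemma laplace_subordinator t g : 0 <= t -> 0 <= g ->
  'M_P (S t) (- g) = (expR (- (g `^ nu * t)))%:E.
Proof.
move=> t0 g0; case: S_stable => _ _ _ _ ->//; last by rewrite oppr_le0.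
by rewrite normrN ger0_norm.
Qed.

Let lbound0 t w : lbound [set s | 0 <= s /\ t < S s w] 0.
Proof. by move=> s []. Qed.

Lemma inverse_process_ge0 t w : 0 <= T t w.
Proof.
rewrite /inverse_process.
have [->|/set0P ne] := eqVneq [set s | 0 <= s /\ t < S s w] set0.
  by rewrite inf0.
exact: lb_le_inf.
Qed.

Lemma lt_inverse_process s t w : 0 <= s -> s < T t w -> S s w <= t.
Proof.
move=> s0 sT; rewrite leNgt; apply/negP => tS.
have : T t w <= s by apply: ge_inf; [exists 0; exact: lbound0|].
by rewrite leNgt sT.
Qed.

(** The second hypothesis excludes paths that never exceed [t], on which [T t w] is the default
    value [0]. *)
Lemma le_inverse_process s t w : S s w <= t ->
  (exists r, 0 <= r /\ t < S r w) -> s <= T t w.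
Proof.
move=> St ne; apply: lb_le_inf => // r [r0 tr].
rewrite leNgt; apply/negP => rs.
by have := lt_le_trans tr (S_mono w r0 (ltW rs)); rewrite ltNge St.
Qed.

Lemma measurable_subordinator_le s t : 0 <= s ->
  measurable [set w | S s w <= t].
Proof. by move=> s0; apply: measurable_set_le; exact: mS. Qed.

Lemma measurable_inverse_process t : measurable_fun [set: W] (T t).
Proof.
apply: (measurability _ (RGenInftyO.measurableE R)) => //.
move=> _ [_ [x ->] <-]; rewrite setTI.
have [x0|x0] := leP x 0.
  rewrite (_ : _ @^-1` _ = set0)//; apply/seteqP; split => // w /=.
  by rewrite in_itv/= ltNge (le_trans x0)// inverse_process_ge0.
(* By monotonicity of the path, [T t w < x] is witnessed at a rational time. Paths that never exceed
   [t] have [T t w = 0] by default and form the second set below. *)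
pose A (r : rat) : set W := if (0 <= ratr r :> R) && (ratr r < x)
  then ~` [set w | S (ratr r) w <= t] else set0.
have mA r : measurable (A r).
  rewrite /A; case: ifP => // /andP[r0 _].
  by apply: measurableC; exact: measurable_subordinator_le.
rewrite (_ : _ @^-1` _ =
  (\bigcup_r A r) `|` (\bigcap_n [set w | S n%:R w <= t])).
  apply: measurableU; first exact: bigcupT_measurable_rat.
  by apply: bigcapT_measurable => n; exact: measurable_subordinator_le.
apply/seteqP; split => w /=; rewrite in_itv/=.
  have [[r [r0 tr]]|nex] := pselect (exists r, 0 <= r /\ t < S r w).
    move=> Tx; left.
    have [r' [r'0 tr'] r'x] : exists2 r', 0 <= r' /\ t < S r' w & r' < x.
      by apply: inf_lt => //; exists r.
    have [a] := rat_in_itvoo r'x; rewrite in_itv/= => /andP[ra ax].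
    exists a => //; rewrite /A (le_trans r'0 (ltW ra)) ax /=.
    apply/negP; rewrite -ltNge; apply: lt_le_trans tr' _.
    by apply: S_mono => //; exact: ltW.
  move=> _; right => n _ /=; rewrite leNgt; apply/negP => h; apply: nex.
  by exists n%:R.
case=> [[a _]|St].
  rewrite /A; case: ifP => // /andP[a0 ax] /= /negP; rewrite -ltNge => tS.
  apply: le_lt_trans ax; apply: ge_inf; first by exists 0; exact: lbound0.
  by [].
rewrite /inverse_process (_ : [set s | _] = set0) ?inf0//.
apply/seteqP; split => // s [s0 ts].
have := St (Num.truncn s).+1 I; rewrite /= leNgt => /negP; apply.
apply: lt_le_trans ts _; apply: S_mono => //.
by rewrite ltW// truncnS_gt.
Qed.

Lemma prob_subordinator_le s t g : 0 <= s -> 0 <= g ->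
  (P [set w | S s w <= t]%R <= (expR (g * t - g `^ nu * s))%:E)%E.
Proof.
move=> s0 g0.
rewrite -(lee_pmul2l (x := (expR (- (g * t)))%:E)) ?lte_fin ?expR_gt0//.
apply: (@le_trans _ _ ('M_P (S s) (- g))).
  apply: expR_prob_le_mmt; first exact: mS.
    exact: measurable_subordinator_le.
  by move=> w /= St; rewrite mulNr lerN2 ler_wpM2l.
rewrite laplace_subordinator// -EFinM -expRD lee_fin ler_expR le_eqVlt.
by apply/orP; left; apply/eqP; ring.
Qed.

Lemma prob_inverse_process_gt s t g : 0 <= s -> 0 <= g ->
  (P [set w | s < T t w]%R <= (expR (g * t - g `^ nu * s))%:E)%E.
Proof.
move=> s0 g0; apply: le_trans (prob_subordinator_le t s0 g0).
apply: le_measure; rewrite ?inE.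
- by apply: measurable_set_gt; exact: measurable_inverse_process.
- exact: measurable_subordinator_le.
- by move=> w; exact: lt_inverse_process.
Qed.

Let prob_eq0 (A : set W) :
  (forall e, 0 < e -> (P A <= e%:E)%E) -> P A = 0%E.
Proof.
move=> PA; apply/eqP; rewrite eq_le measure_ge0 andbT.
by apply/lee_addgt0Pr => e e0; rewrite add0e; exact: PA.
Qed.

(** This is the event where [T t] takes its default value. Chernoff's bound with [g = 1] reads
    [exp (t - n)], below [e] for [n > t - ln e]. *)
Lemma subordinator_unbounded t : P (\bigcap_n [set w | S n%:R w <= t]) = 0%E.
Proof.
apply: prob_eq0 => // e e0.
pose n := (Num.truncn (t - ln e)).+1.
apply: (@le_trans _ _ (P [set w | S n%:R w <= t]%R)).
  apply: le_measure; rewrite ?inE.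
  - by apply: bigcapT_measurable => m; exact: measurable_subordinator_le.
  - exact: measurable_subordinator_le.
  - by move=> w; apply.
apply: le_trans (prob_subordinator_le t (ler0n R n) ler01) _.
rewrite lee_fin powR1 !mul1r -[leRHS]lnK ?posrE// ler_expR.
rewrite lerBlDr -lerBlDl ltW//; exact: truncnS_gt.
Qed.

Lemma inverse_process0 : P [set w | T 0 w != 0] = 0%E.
Proof.
apply: prob_eq0 => // e e0.
rewrite (_ : [set w | _] = \bigcup_n [set w | n.+1%:R^-1 < T 0 w]); last first.
  apply/seteqP; split => w /=.
    move=> Tn; have T0 : 0 < T 0 w by rewrite lt0r Tn inverse_process_ge0.
    have [n _ /(_ n (leqnn n)) nT] := near_infty_natSinv_lt (PosNum T0).
    by exists n.
  by move=> [n _ /=] nT; rewrite gt_eqF// (lt_trans _ nT)// invr_gt0.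
have mB n : measurable [set w | n.+1%:R^-1 < T 0 w].
  by apply: measurable_set_gt; exact: measurable_inverse_process.
suff -> : P (\bigcup_n [set w | n.+1%:R^-1 < T 0 w]) = 0%E.
  by rewrite lee_fin ltW.
apply: measure_negligible; first exact: bigcupT_measurable.
apply: negligible_bigcup => n; apply/negligibleP; first exact: mB.
apply: prob_eq0 => // {e0}e e0.
(* At [t = 0] the tail bound is [exp (- g^nu s)]; this [g] makes the exponent [- |ln e|] at
   [s = 1 / (n + 1)]. *)
pose g := (`|ln e| * n.+1%:R) `^ nu^-1.
have n0 : 0 <= n.+1%:R^-1 :> R by rewrite invr_ge0.
apply: le_trans (@prob_inverse_process_gt _ 0 g n0 (powR_ge0 _ _)) _.
rewrite lee_fin mulr0 sub0r /g -powRrM mulVf ?gt_eqF// powRr1; last first.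
  by rewrite mulr_ge0.
rewrite mulfK ?pnatr_eq0// -[leRHS]lnK ?posrE// ler_expR lerNl.
by rewrite -normrN ler_norm.
Qed.

End inverse_subordinator.

Lemma nneseries_geometric_le (R : realType) (c rho : R) :
  0 <= c -> 0 <= rho < 1 ->
  (\sum_(0 <= j <oo) (c * rho ^+ j)%:E <= (c / (1 - rho))%:E)%E.
Proof.
move=> c0 /andP[rho0 rho1]; have r10 : 0 < 1 - rho by rewrite subr_gt0.
apply: lime_le.
  by apply: is_cvg_nneseries => n _ _; rewrite lee_fin mulr_ge0 ?exprn_ge0.
apply: nearW => n; rewrite sumEFin lee_fin -mulr_sumr ler_wpM2l//.
rewrite -div1r ler_pdivlMr// big_mkord mulrC.
rewrite -[X in X * _]opprB mulNr -subrX1 opprB.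
by rewrite lerBlDr lerDl exprn_ge0.
Qed.

Lemma near_pinfty_div (R : realType) (c : R) (A : R -> Prop) : 0 < c ->
  (\forall s \near +oo, A s) -> \forall t \near +oo, A (t / c).
Proof.
move=> c0 [M [Mreal MA]]; exists (M * c); split; first by rewrite num_real.
by move=> t Mt; apply: MA; rewrite ltr_pdivlMr.
Qed.

(** * Growth of the exponential moments of the inverse subordinator *)

Section moments_of_inverse.
Context (R : realType) d (W : measurableType d) (P : probability W R).
Variables (nu : R) (S : R -> W -> R).
Hypotheses (nu_gt0 : 0 < nu) (nu_lt1 : nu < 1).
Hypothesis S_stable : stable_subordinator P nu S.
Local Notation T := (inverse_process S).

Let mT t : measurable_fun [set: W] (T t).
Proof. exact: measurable_inverse_process S_stable t. Qed.

(** [exp (theta T)] is cut along the events [j < T]; the tail bound turns the sum into a geometric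
    series of ratio [exp (theta - g^nu) < 1]. The summand [1] covers [T = 0]. *)
Lemma mmt_inverse_process_le_geometric (theta g t : R) : 0 <= theta -> 0 <= g ->
  theta < g `^ nu ->
  ('M_P (T t) theta <=
   (1 + expR (2 * theta + g * t) / (1 - expR (theta - g `^ nu)))%:E)%E.
Proof.
move=> th0 g0 thg; rewrite mmt_gen_funE.
pose B (j : nat) := [set w | j%:R < T t w].
have mB j : measurable (B j) by apply: measurable_set_gt; exact: mT.
(* With [j = truncn T - 1] one has [j < T <= j + 2] as soon as [0 < T]. *)
pose f (j : nat) (w : W) : \bar R :=
  ((expR (theta * j.+2%:R))%:E * (\1_(B j) w)%:E)%E.
have f0 j w : (0 <= f j w)%E by rewrite mule_ge0// lee_fin ?expR_ge0.
have mf j : measurable_fun setT (f j).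
  by apply: measurable_funeM; exact/measurable_EFinP/measurable_indic.
apply: (@le_trans _ _ (\int[P]_w (1 + \sum_(0 <= j <oo) f j w)%E)%E).
  apply: ge0_le_integral => //.
  - exact: measurable_expRM.
  - apply: emeasurable_funD => //; apply: ge0_emeasurable_sum => //.
  move=> w _; have [T0|T0] := leP (T t w) 0.
    have -> : T t w = 0 by apply/le_anti; rewrite T0 (inverse_process_ge0 S).
    by rewrite mulr0 expR0 leeDl// nneseries_ge0.
  pose j := (Num.truncn (T t w)).-1.
  have jT : j%:R < T t w.
    rewrite /j; case E : (Num.truncn (T t w)) => [|m] //=.
    have : m.+1%:R <= T t w by rewrite -E truncn_le// ltW.
    by apply: lt_le_trans; rewrite ltr_nat.
  have Tj : T t w <= j.+2%:R.
    apply: le_trans (ltW (truncnS_gt _)) _.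
    by rewrite ler_nat /j; case: (Num.truncn _).
  rewrite -[leLHS]add0e leeD//.
  apply: (@le_trans _ _ (f j w)).
    by rewrite /f indicE mem_set//= mule1 lee_fin ler_expR ler_wpM2l.
  rewrite nneseries_esumT//.
  have := @le_seq_esum _ _ (f ^~ w) [:: j] isT.
  by rewrite big_seq1.
rewrite ge0_integralD//; last 2 first.
- by move=> w _; rewrite nneseries_ge0.
- exact: ge0_emeasurable_sum.
have -> : (\int[P]_w 1 = 1)%E.
  by rewrite integral_cst// mul1e; exact: probability_setT.
rewrite EFinD leeD2l//.
rewrite integral_nneseries//.
have rho1 : expR (theta - g `^ nu) < 1 by rewrite expR_lt1 subr_lt0.
apply: le_trans
  (nneseries_geometric_le (expR_ge0 (2 * theta + g * t)) _); last first.
  by rewrite expR_ge0.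
apply: lee_nneseries => [j _ _|j _].
  by apply: integral_ge0 => w _.
rewrite ge0_integralZl_EFin ?expR_ge0//; last first.
  exact/measurable_EFinP/measurable_indic.
rewrite integral_indic// setIT.
apply: (@le_trans _ _ ((expR (theta * j.+2%:R))%:E *
    (expR (g * t - g `^ nu * j%:R))%:E)%E).
  rewrite lee_wpmul2l ?lee_fin ?expR_ge0//.
  exact: (prob_inverse_process_gt S_stable).
rewrite -EFinM -expRD -expRM_natr -expRD lee_fin ler_expR le_eqVlt.
by apply/orP; left; apply/eqP; rewrite -[j.+2]addn2 natrD; ring.
Qed.

Local Notation psi := (truncated_power (1 / nu)).

Lemma mmt_inverse_process_upper (theta eta : R) : 0 < eta ->
  \forall t \near +oo,
  ('M_P (T t) theta <= (expR (t * (psi theta + eta)))%:E)%E.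
Proof.
move=> eta0; rewrite /truncated_power; case: ifPn => [th0|].
  (* Just above the threshold [theta^(1/nu)] of convergence; the other half of [eta] absorbs the
     constant [A]. *)
  pose g := theta `^ (1 / nu) + eta / 2.
  have g00 : 0 < g by rewrite ltr_wpDl ?powR_ge0// divr_gt0.
  have thg : theta < g `^ nu.
    rewrite -[ltLHS](_ : (theta `^ (1 / nu)) `^ nu = _); last first.
      by rewrite -powRrM mul1r mulVf ?gt_eqF// powRr1.
    apply: gt0_ltr_powR; rewrite ?nnegrE ?powR_ge0 ?(ltW g00)//.
    by rewrite ltrDl divr_gt0.
  pose A := 1 + expR (2 * theta) / (1 - expR (theta - g `^ nu)).
  have c0 : 0 < 1 - expR (theta - g `^ nu).
    by rewrite subr_gt0 expR_lt1 subr_lt0.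
  have A0 : 0 < A by rewrite ltr_pwDl// divr_ge0 ?expR_ge0// ltW.
  near=> t; have t0 : 0 < t by near: t; exact: nbhs_pinfty_gt.
  apply: le_trans (mmt_inverse_process_le_geometric t th0 (ltW g00) thg) _.
  rewrite lee_fin; apply: (@le_trans _ _ (A * expR (g * t))).
    have Y1 : 1 <= expR (g * t).
      by rewrite -[leLHS]expR0 ler_expR mulr_ge0 ?(ltW g00) ?(ltW t0).
    rewrite [expR (_ + g * t)]expRD /A.
    move: (expR (g * t)) Y1 (expR (2 * theta)) ((1 - _)^-1) => Y Y1 X Z.
    by rewrite -subr_ge0 (_ : _ - _ = Y - 1) ?subr_ge0//; ring.
  have At : A <= expR (t * (eta / 2)).
    apply: le_trans (expR_ge1Dx _); apply: ler_wpDl => //.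
    rewrite -ler_pdivrMr ?divr_gt0//.
  apply: le_trans (ler_wpM2r (expR_ge0 _) At) _; rewrite -expRD ler_expR /g.
  rewrite le_eqVlt; apply/orP; left; apply/eqP; by field.
rewrite -ltNge => th0; near=> t.
have t0 : 0 < t by near: t; exact: nbhs_pinfty_gt.
rewrite mmt_gen_funE.
apply: (@le_trans _ _ (\int[P]_w 1)%E).
  apply: ge0_le_integral => //.
    by apply: measurable_expRM; exact: mT.
  move=> w _; rewrite lee_fin -[leRHS]expR0 ler_expR mulr_le0_ge0 ?(ltW th0)//.
  exact: inverse_process_ge0.
have -> : (\int[P]_w 1 = 1)%E.
  by rewrite integral_cst// mul1e; exact: probability_setT.
rewrite lee_fin -[leLHS]expR0 ler_expR.
by rewrite add0r mulr_ge0 ?(ltW t0) ?(ltW eta0).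
Unshelve. all: by end_near. Qed.

End moments_of_inverse.

Section moments_of_inverse.
Context (R : realType) d (W : measurableType d) (P : probability W R).
Variables (nu : R) (S : R -> W -> R).
Hypotheses (nu_gt0 : 0 < nu) (nu_lt1 : nu < 1).
Hypothesis S_stable : stable_subordinator P nu S.
Local Notation T := (inverse_process S).

Let mT t : measurable_fun [set: W] (T t).
Proof. exact: measurable_inverse_process S_stable t. Qed.

Let mS t : 0 <= t -> measurable_fun [set: W] (S t).
Proof. by case: S_stable => + _ _ _ _; exact. Qed.

Local Notation psi := (truncated_power (1 / nu)).

Let prob_compl_ge (A : set W) (c : R) : measurable A -> (P (~` A) <= c%:E)%E ->
  ((1 - c)%:E <= P A)%E.
Proof.
move=> mA cA; have mC : measurable (~` A) by exact: measurableC.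
rewrite -[A]setCK probability_setC// EFinB.
by apply: leeB.
Qed.

(** As [nu < 1], [T t] is sublinear in probability: [T t <= delta t] has probability at least
    [1 / 2] for large [t], so the moment is at least [exp (theta delta t) / 2]. *)
Lemma mmt_inverse_process_lower_le0 (theta eta : R) : theta <= 0 -> 0 < eta ->
  \forall t \near +oo, ((expR (- (t * eta)))%:E <= 'M_P (T t) theta)%E.
Proof.
move=> th0 eta0.
pose delta := eta / (2 * (`|theta| + 1)).
have delta0 : 0 < delta by rewrite divr_gt0// mulr_gt0// ltr_wpDl.
have thdelta : - (eta / 2) <= theta * delta.
  have -> : eta / 2 = (`|theta| + 1) * delta.
    by rewrite /delta; field; rewrite gt_eqF// ltr_wpDl.
  rewrite -mulNr ler_wpM2r ?(ltW delta0)//.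
  by rewrite lerNl (le_trans (ler_norm _))// normrN lerDl.
have nu10 : 0 < 1 - nu by rewrite subr_gt0.
(* Solves [g = g^nu * delta / 2], so that half of [g^nu * delta * t] survives in the tail bound for
   [T t > delta t]. *)
pose g := (delta / 2) `^ (1 - nu)^-1.
have g0 : 0 < g by rewrite powR_gt0// divr_gt0.
have gdelta : g = g `^ nu * (delta / 2).
  rewrite -[X in _ = _ * X](_ : g `^ (1 - nu) = _); last first.
    by rewrite /g -powRrM mulVf ?gt_eqF// powRr1// ltW// divr_gt0.
  rewrite -powRD; last by rewrite (gt_eqF g0) implybT.
  by rewrite (_ : nu + (1 - nu) = 1) ?powRr1// ?ltW//; ring.
pose c := g `^ nu * (delta / 2).
have c0 : 0 < c by rewrite mulr_gt0 ?powR_gt0// divr_gt0.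
near=> t; have t0 : 0 < t by near: t; exact: nbhs_pinfty_gt.
have mA : measurable [set w | T t w <= delta * t] by exact: measurable_set_le.
have PA : ((2^-1)%:E <= P [set w | T t w <= delta * t]%R)%E.
  have -> : 2^-1 = 1 - 2^-1 :> R by field.
  apply: prob_compl_ge => //.
  rewrite (_ : ~` _ = [set w | delta * t < T t w]); last first.
    by apply/seteqP; split => w /=; rewrite ltNge => /negP.
  have dt0 : 0 <= delta * t by rewrite mulr_ge0 ?(ltW delta0) ?(ltW t0).
  apply: le_trans (prob_inverse_process_gt S_stable t dt0 (ltW g0)) _.
  rewrite lee_fin (_ : g * t - _ = - (t * c)); last first.
    by rewrite {1}gdelta /c; field.
  rewrite expRN lef_pV2 ?posrE ?expR_gt0//.
  apply: le_trans (expR_ge1Dx _); rewrite -lerBlDl.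
  rewrite (_ : 2 - 1 = 1); last by ring.
  by rewrite -ler_pdivrMr.
apply: (@le_trans _ _
  ((expR (theta * delta * t))%:E * (2^-1)%:E)%E); last first.
  apply: (@le_trans _ _ ((expR (theta * delta * t))%:E *
      P [set w | T t w <= delta * t]%R)%E).
    by rewrite lee_wpmul2l// lee_fin expR_ge0.
  apply: expR_prob_le_mmt => //.
  by move=> w /= Tw; rewrite -mulrA ler_wnM2l.
rewrite -EFinM lee_fin ler_pdivlMr//.
apply: (@le_trans _ _ (expR (- (t * eta)) * expR (t * (eta / 2)))).
  rewrite ler_wpM2l ?expR_ge0//.
  apply: le_trans (expR_ge1Dx _); rewrite -lerBlDl.
  rewrite (_ : 2 - 1 = 1); last by ring.
  by rewrite -ler_pdivrMr ?divr_gt0.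
rewrite -expRD ler_expR.
have := ler_wpM2r (ltW t0) thdelta; lra.
Unshelve. all: by end_near. Qed.

(** [S s <= t] forces [s <= T t] only on paths that eventually exceed [t]; the others form the null
    event [N], removed before the exponential Chebyshev inequality applies. *)
Let expR_prob_le_inverse (theta s t : R) : 0 <= theta -> 0 <= s ->
  ((expR (theta * s))%:E * P [set w | S s w <= t]%R <= 'M_P (T t) theta)%E.
Proof.
move=> th0 s0; pose N := \bigcap_n [set w | S n%:R w <= t].
have mN : measurable N.
  apply: bigcapT_measurable => n.
  exact: (measurable_subordinator_le S_stable).
have mB := measurable_subordinator_le S_stable t s0.
have -> : P [set w | S s w <= t] = P ([set w | S s w <= t] `\` N).
  apply/eqP; rewrite eq_le; apply/andP; split; last first.
    by apply: le_measure; rewrite ?inE//; exact: measurableD.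
  rewrite -[leRHS]adde0 -(subordinator_unbounded S_stable t).
  apply: le_trans (measureU2 _ (measurableD mB mN) mN).
  apply: le_measure; rewrite ?inE//.
    by apply: measurableU => //; exact: measurableD.
  by move=> w Bw; have [|] := pselect (N w); [right|left].
apply: expR_prob_le_mmt => //; first exact: measurableD.
move=> w [/= Sw Nw]; rewrite ler_wpM2l//.
apply: (le_inverse_process S_stable) => //.
apply: contrapT => nex; apply: Nw => n _ /=; rewrite leNgt; apply/negP => tS.
by apply: nex; exists n%:R.
Qed.

(** For [x <= 0], [- |x|^nu] is the cumulant of the subordinator per unit of time; its slope at
    [- g] is the speed of [S] under the tilt. *)
Lemma is_derive_cumulant_subordinator (g : R) : 0 < g ->
  is_derive (- g) 1 (fun x => - (`|x| `^ nu)) (nu * g `^ (nu - 1)).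
Proof.
move=> g0; apply: (@near_eq_is_derive _ _ _ (fun x : R => - ((- x) `^ nu))).
  near=> x; rewrite ltr0_norm//.
  by near: x; apply: lt_nbhsl; rewrite oppr_lt0.
have D1 : is_derive (- - g) 1 (fun x => x `^ nu) (nu * g `^ (nu - 1)).
  by rewrite opprK; exact: is_derive1_powR.
have D2 : is_derive (- g) 1 (-%R : R -> R) (-1) by exact: is_deriveNid.
have D3 := is_derive1_comp D1 D2.
have := is_deriveN D3; congr is_derive.
by rewrite mulrN1 opprK.
Unshelve. all: by end_near. Qed.

(* Under the tilt [- g], [S s] is close to [s y]; hence [T t >= s] for [s]
   close to [t / y] on an event of probability at least of order
   [exp (s (g y - theta))]. *)
Lemma mmt_inverse_process_lower_gt0 (theta eta : R) : 0 < theta -> 0 < eta ->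
  \forall t \near +oo,
  ((expR (t * (theta `^ (1 / nu) - eta)))%:E <= 'M_P (T t) theta)%E.
Proof.
move=> th0 eta0; set g := theta `^ (1 / nu).
have g0 : 0 < g by exact: powR_gt0.
have gnu : g `^ nu = theta.
  by rewrite -powRrM mul1r mulVf ?gt_eqF// powRr1// ltW.
pose y := nu * g `^ (nu - 1).
have y0 : 0 < y by rewrite mulr_gt0// powR_gt0.
(* Makes [3 g k = eta y]: [2 g k] is lost in the local lower bound, and [g k] because
   [t = s (y + k)] and not [s y]. *)
pose k := eta * y / (3 * g).
have k0 : 0 < k by rewrite divr_gt0// mulr_gt0.
have kE : 3 * g * k = eta * y by rewrite /k mulrC divfK// gt_eqF// mulr_gt0.
pose L (x : R) := - (`|x| `^ nu).
have [e /andP[e0 eg] [ep em]] :=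
  derivable_near_slope (is_derive_cumulant_subordinator g0) k0 g0.
have laplace x s : 0 <= s -> x <= 0 -> 'M_P (S s) x = (expR (s * L x))%:E.
  move=> s0 x0; rewrite -[in LHS](opprK x) (laplace_subordinator S_stable)//.
    by rewrite /L mulrN mulrC ler0_norm.
  by rewrite oppr_ge0.
have lg : L (- g) = - theta by rewrite /L normrN gtr0_norm// gnu.
have gk0 : 0 < g * k by rewrite mulr_gt0.
have H := @local_lower_bound _ _ _ P S (- g) y k (L (- g)) (L (- g + e))
  (L (- g - e)) e e (fun t t0 => mS (ltW t0)) (ltW e0) (ltW e0) _ _ _ _ _ _ gk0.
have {}H : \forall s \near +oo, ((expR (s * (g * (y - 2 * k) - theta)))%:E <=
    P [set w | `|S s w - s * y| < s * k]%R)%E.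
  have -> : g * (y - 2 * k) - theta = L (- g) - - g * y - `|- g| * k - g * k.
    by rewrite lg normrN gtr0_norm//; ring.
  apply: H.
  - by move: ep; rewrite /L /y; lra.
  - by move: em; rewrite /L /y; lra.
  - move=> eta' eta'0; near=> s.
    have s0 : 0 < s by near: s; exact: nbhs_pinfty_gt.
    rewrite laplace ?oppr_le0 ?(ltW s0) ?(ltW g0)// lee_fin ler_expR.
    by rewrite ler_wpM2l ?(ltW s0)// gerBl ltW.
  - near=> s; have s0 : 0 < s by near: s; exact: nbhs_pinfty_gt.
    by rewrite laplace ?(ltW s0)//; lra.
  - near=> s; have s0 : 0 < s by near: s; exact: nbhs_pinfty_gt.
    by rewrite laplace ?(ltW s0)//; lra.
have yk0 : 0 < y + k by rewrite addr_gt0.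
have {}H := near_pinfty_div yk0 H.
near=> t; have t0 : 0 < t by near: t; exact: nbhs_pinfty_gt.
have : ((expR (t / (y + k) * (g * (y - 2 * k) - theta)))%:E <=
    P [set w | `|S (t / (y + k)) w - t / (y + k) * y| < t / (y + k) * k]%R)%E.
  by near: t.
set s := t / (y + k).
have s0 : 0 < s by rewrite divr_gt0.
have ts : t = s * (y + k) by rewrite /s divfK// gt_eqF.
move=> Hs; apply: le_trans (expR_prob_le_inverse t (ltW th0) (ltW s0)).
apply: (@le_trans _ _ ((expR (theta * s))%:E *
    (expR (s * (g * (y - 2 * k) - theta)))%:E)%E).
  rewrite -EFinM -expRD lee_fin ler_expR {1}ts -subr_ge0.
  rewrite (_ : _ - _ = s * (eta * y + eta * k - 3 * g * k)); last by ring.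
  rewrite kE mulr_ge0 ?(ltW s0)// addrAC subrr add0r.
  by rewrite mulr_ge0 ?(ltW k0) ?(ltW eta0).
rewrite lee_wpmul2l ?lee_fin ?expR_ge0//; apply: le_trans Hs _.
apply: le_measure; rewrite ?inE.
- by apply: measurable_set_dist_lt; exact: mS (ltW s0).
- exact: (measurable_subordinator_le S_stable) (ltW s0).
- move=> w /=; rewrite ltr_norml => /andP[_]; rewrite [X in _ <= X]ts; lra.
Unshelve. all: by end_near. Qed.

Theorem mmt_inverse_process_asymp (theta eta : R) : 0 < eta ->
  \forall t \near +oo,
  ((expR (t * (psi theta - eta)))%:E <= 'M_P (T t) theta <=
   (expR (t * (psi theta + eta)))%:E)%E.
Proof.
move=> eta0; near=> t; apply/andP; split; near: t; last first.
  exact: (mmt_inverse_process_upper nu_gt0 S_stable).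
have [th0|th0] := leP theta 0; last first.
  rewrite /truncated_power (ltW th0); exact: mmt_inverse_process_lower_gt0.
have -> : psi theta = 0.
  rewrite /truncated_power; case: ifPn => // th0'.
  have -> : theta = 0 by apply/le_anti; rewrite th0.
  by rewrite powR0// gt_eqF// divr_gt0.
have := mmt_inverse_process_lower_le0 th0 eta0; apply: filterS => t.
by rewrite sub0r mulrN.
Unshelve. all: by end_near. Qed.

End moments_of_inverse.

(** * Time change *)

Section right_continuity.
Context (R : realType) (p : int -> int -> R -> R) (qu qd : int -> R).
Hypothesis p_trans : transition_function p.
Hypothesis p_gen : has_generator p (birth_death_generator qu qd).
Hypotheses (qu_ge0 : forall k, 0 <= qu k) (qd_ge0 : forall k, 0 <= qd k).

Lemma transition_right_continuous k n t : 0 <= t ->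
  p k n s @[s --> t^'+] --> p k n t.
Proof.
move=> t0; apply/cvgrPdist_le => e e0.
have [delta d0 H] := transition_one_step p_trans p_gen qu_ge0 qd_ge0 k ltr01.
set D := birth_death_drift qu qd (fun l => p l n t) k.
have D0 : 0 < `|D| + 1 by rewrite ltr_wpDl.
near=> s.
have ts : t < s by near: s; exact: nbhs_right_gt.
have sd : s < t + delta by near: s; apply: nbhs_right_lt; rewrite ltrDl.
have se : s < t + e / (`|D| + 1).
  by near: s; apply: nbhs_right_lt; rewrite ltrDl divr_gt0.
have r0 : 0 < s - t by rewrite subr_gt0.
have rd : 0 < s - t < delta by rewrite r0 ltrBlDl.
have := H (s - t) t n rd t0; rewrite [t + _]addrC subrK -/D mul1r => h.
rewrite distrC; apply: (@le_trans _ _ ((s - t) * (`|D| + 1))).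
  have hD : `|(s - t) * D| = (s - t) * `|D| by rewrite normrM gtr0_norm.
  rewrite -[X in `|X| <= _](subrK ((s - t) * D)).
  by rewrite (le_trans (ler_normD _ _))// hD [leRHS]mulrDr mulr1 addrC lerD2l.
by rewrite -ler_pdivlMr// lerBlDl ltW.
Unshelve. all: by end_near. Qed.

End right_continuity.

Section time_change.
Context (R : realType) d (W : measurableType d) (P : probability W R).
Variables (X : R -> W -> int) (p : int -> int -> R -> R) (tau : W -> R).
Hypothesis X_markov : markov_chain P X p.
Hypothesis p_right : forall k n t, 0 <= t -> p k n s @[s --> t^'+] --> p k n t.
Hypothesis mtau : measurable_fun [set: W] tau.
Hypothesis tau_ge0 : forall w, 0 <= tau w.
Hypothesis tau_indep : forall A B, process_sigma [set: set int] X A ->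
  measurable B -> P (A `&` tau @^-1` B) = (P A * P (tau @^-1` B))%E.

Let p_trans : transition_function p.
Proof. by case: X_markov. Qed.

Let mX t k : 0 <= t -> measurable [set w | X t w = k].
Proof. by move=> t0; case: X_markov => _ + _ _; exact. Qed.

Let grid (m j : nat) : R := j.+1%:R / m.+1%:R.
Let cell (m j : nat) : set R := `[j%:R / m.+1%:R, j.+1%:R / m.+1%:R[.
Let index (m : nat) (w : W) : nat := Num.truncn (tau w * m.+1%:R).

Let m0 m : 0 < m.+1%:R :> R. Proof. by rewrite ltr0n. Qed.

Let grid_gt0 m j : 0 < grid m j. Proof. by rewrite divr_gt0// ltr0n. Qed.

Let cellE m j : tau @^-1` cell m j = [set w | index m w = j].
Proof.
have x0 w : 0 <= tau w * m.+1%:R by rewrite mulr_ge0.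
apply/seteqP; split => w /=;
  rewrite /cell /= in_itv/= ler_pdivrMr// ltr_pdivlMr//.
  by move=> h; exact: truncn_def.
by move=> <-; exact: truncn_itv.
Qed.

Let mcell m j : measurable [set w | index m w = j].
Proof.
rewrite -cellE -[X in measurable X]setTI; apply: mtau => //.
exact: measurable_itv.
Qed.

(* [tau_ m] approximates [tau] strictly from the right, so that the
   right-continuity of the paths applies. *)
Let tau_ m w := grid m (index m w).

Let tau_gt m w : tau w < tau_ m w.
Proof. by rewrite /tau_ /grid ltr_pdivlMr// truncnS_gt. Qed.

Let tau_ge0' m w : 0 <= tau_ m w.
Proof. by rewrite ltW// grid_gt0. Qed.

Let tau_le m w : tau_ m w <= tau w + m.+1%:R^-1.
Proof.
rewrite /tau_ /grid ler_pdivrMr// mulrDl mulVf ?gt_eqF// -natr1 lerD2r.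
by rewrite truncn_le mulr_ge0.
Qed.

Let tau_cvg w : tau_ m w @[m --> \oo] --> (tau w)^'+.
Proof.
move=> A [/= e e0 eA].
have [N _ NP] := near_infty_natSinv_lt (PosNum e0).
exists N => // m Nm; apply: eA; last exact: tau_gt.
rewrite /ball/= distrC ger0_norm ?subr_ge0 ?(ltW (tau_gt _ _))//.
by rewrite ltrBlDl (le_lt_trans (tau_le _ _))// ltrD2l; exact: NP.
Qed.

Let transition_cvg k n w :
  p k n (tau_ m w) @[m --> \oo] --> p k n (tau w).
Proof.
move=> A pA; have := @tau_cvg w ((fun s => p k n s) @^-1` A); apply.
exact: p_right pA.
Qed.

Let setT_cells m : [set: W] = \bigcup_j [set w | index m w = j].
Proof. by apply/seteqP; split => // w _; exists (index m w). Qed.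

Let setI_cells m (A : set W) :
  A = \bigcup_j (A `&` [set w | index m w = j]).
Proof. by rewrite -setI_bigcupr -setT_cells setIT. Qed.

Let trivIset_cells m (A : nat -> set W) :
  trivIset setT (fun j => A j `&` [set w | index m w = j]).
Proof. by move=> i j _ _ [w [[_ <-] [_ <-]]]. Qed.

Let state_cells m n : [set w | X (tau_ m w) w = n] =
  \bigcup_j ([set w | X (grid m j) w = n] `&` [set w | index m w = j]).
Proof.
apply/seteqP; split => w /=; first by move=> Xn; exists (index m w).
by move=> [j _ [/= Xj Ij]]; rewrite /tau_ Ij.
Qed.

Let mstate_ m n : measurable [set w | X (tau_ m w) w = n].
Proof.
rewrite state_cells; apply: bigcupT_measurable => j; apply: measurableI => //.
by apply: mX; exact: ltW.
Qed.

Let state_eventually w : \forall m \near \oo, X (tau_ m w) w = X (tau w) w.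
Proof.
case: X_markov => _ _ /(_ w (tau w) (tau_ge0 w)) Xr _.
exact: tau_cvg Xr.
Qed.

Let indic_cvg (A_ : nat -> set W) (A : set W) :
  (forall w, \forall m \near \oo, A_ m w <-> A w) ->
  forall w, (\1_(A_ m) w)%:E @[m --> \oo] --> (\1_A w : R)%:E.
Proof.
move=> AA w; apply: cvg_near_cst; have := AA w; apply: filterS => m [h1 h2].
rewrite !indicE; congr ((nat_of_bool _)%:R%:E).
by apply/idP/idP => /set_mem h; apply/mem_set; auto.
Qed.

Lemma measurable_time_changed n : measurable [set w | X (tau w) w = n].
Proof.
apply/(measurable_indicP R); apply: measurable_fun_cvg.
  by move=> m; apply: measurable_indic; exact: (mstate_ m n).
move=> w _; apply: cvg_near_cst.
have := state_eventually w; apply: filterS => m E.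
rewrite !indicE; congr ((nat_of_bool _)%:R).
by apply/idP/idP => /set_mem h; apply/mem_set; move: h; rewrite /= E.
Qed.

Lemma markov_two_times k n s : 0 < s ->
  P ([set w | X 0 w = k] `&` [set w | X s w = n]) =
  (P [set w | X 0 w = k] * (p k n s)%:E)%E.
Proof.
move=> s0; case: X_markov => _ _ _ /(_ 0%N (fun i => i%:R * s)
  (fun i => if i is 0%N then k else n)).
rewrite !mul0r mul1r subr0 => /(_ (lexx _)) H.
have -> : [set w | X 0 w = k] `&` [set w | X s w = n] =
    \bigcap_(i in `I_2) X (i%:R * s) @^-1` [set (if i is 0%N then k else n)].
  apply/seteqP; split => w.
    by move=> [/= h1 h2] [|[|//]] _ /=; rewrite ?mul0r ?mul1r.
  move=> h; split; first by have := h 0%N isT; rewrite /= mul0r.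
  by have := h 1%N isT; rewrite /= mul1r.
rewrite H; last first.
  by move=> i; rewrite leqn0 => /eqP ->; rewrite mul0r mul1r.
congr (P _ * _)%E; apply/seteqP; split => w.
  by move=> h; have := h 0%N isT; rewrite /= mul0r.
by move=> /= h [|//] _ /=; rewrite mul0r.
Qed.

Let process_sigma_state t k : 0 <= t ->
  process_sigma [set: set int] X [set w | X t w = k].
Proof. by move=> t0; apply: sub_sigma_algebra; exists t, [set k]. Qed.

Let cell_prob m k n j :
  P (([set w | X 0 w = k] `&` [set w | X (grid m j) w = n]) `&`
     [set w | index m w = j]) =
  (P [set w | X 0 w = k] * (p k n (grid m j))%:E * P [set w | index m w = j])%E.
Proof.
rewrite -cellE tau_indep; last exact: measurable_itv.
  by rewrite markov_two_times.
apply: (@measurableI _ (g_sigma_algebraType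
  [set A | exists t B, [/\ 0 <= t, [set: set int] B & A = X t @^-1` B]])).
  exact: process_sigma_state.
by apply: process_sigma_state; exact: ltW.
Qed.

Let mtransition_ m k n :
  measurable_fun [set: W] (fun w => (p k n (tau_ m w))%:E).
Proof.
rewrite [X in measurable_fun X](setT_cells m).
apply/measurable_fun_bigcup => // j.
apply: (eq_measurable_fun (cst (p k n (grid m j))%:E)).
  by move=> w /set_mem /= <-.
exact: measurable_cst.
Qed.

(** On each cell the sampling time is the constant [grid m j], so independence and the two-time law
    factor every term. *)
Let time_changed_grid m k n :
  P ([set w | X 0 w = k] `&` [set w | X (tau_ m w) w = n]) =
  (P [set w | X 0 w = k] * \int[P]_w (p k n (tau_ m w))%:E)%E.
Proof.
have p0 j : (0 <= (p k n (grid m j))%:E)%E.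
  by rewrite lee_fin; case: p_trans => + _ _ _; apply; exact: ltW.
rewrite state_cells setI_bigcupr; under eq_bigcupr do rewrite setIA.
have mE : measurable [set w | X 0 w = k] by exact: mX.
have mEj j : measurable ([set w | X 0 w = k] `&` [set w | X (grid m j) w = n]
    `&` [set w | index m w = j]).
  apply: measurableI => //; apply: measurableI => //.
  by apply: mX; exact: ltW.
rewrite measure_semi_bigcup//; last exact: bigcupT_measurable.
have -> : (\int[P]_w (p k n (tau_ m w))%:E =
    \sum_(0 <= j <oo) (p k n (grid m j))%:E * P [set w | index m w = j])%E.
  rewrite (setT_cells m) ge0_integral_bigcup//; last 3 first.
  - by rewrite -(setT_cells m).
  - by move=> w _; exact: p0.
  - have := @trivIset_cells m (fun=> setT).
    by under eq_fun do rewrite setTI.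
  apply: eq_eseriesr => j _; rewrite -integral_cst//.
  by apply: eq_integral => w /set_mem /= <-.
rewrite -(fineK (fin_num_measure P _ mE)) -nneseriesZl; last first.
  by move=> j _; rewrite mule_ge0.
apply: eq_eseriesr => j _.
by rewrite (fineK (fin_num_measure P _ mE)) muleA -cell_prob.
Qed.

Lemma transition_time_changed_measurable k n :
  measurable_fun [set: W] (fun w => (p k n (tau w))%:E).
Proof.
apply: emeasurable_fun_cvg; first by move=> m; exact: (mtransition_ m k n).
move=> w _; apply: cvg_EFin; first exact: nearW.
exact: transition_cvg.
Qed.

(** Both sides pass to the limit by dominated convergence as the grid times decrease to [tau]: the
    left through right-continuity of the paths, the right through that of [p]. *)
Theorem time_changed_law k n :
  P ([set w | X 0 w = k] `&` [set w | X (tau w) w = n]) =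
  (P [set w | X 0 w = k] * \int[P]_w (p k n (tau w))%:E)%E.
Proof.
have mE : measurable [set w | X 0 w = k] by exact: mX.
have one_int : P.-integrable [set: W] (cst (1%E : \bar R)).
  exact: finite_measure_integrable_cst.
have L1 : (P ([set w | X 0 w = k] `&` [set w | X (tau_ m w) w = n]))
    @[m --> \oo] --> P ([set w | X 0 w = k] `&` [set w | X (tau w) w = n]).
  have mA m : measurable ([set w | X 0 w = k] `&` [set w | X (tau_ m w) w = n]).
    exact: measurableI.
  have mB : measurable ([set w | X 0 w = k] `&` [set w | X (tau w) w = n]).
    by apply: measurableI => //; exact: measurable_time_changed.
  rewrite -[X in _ --> P X]setIT -integral_indic//.
  under eq_fun do rewrite -[X in P X]setIT -integral_indic//.
  apply: (@dominated_cvg _ _ _ _ _ measurableT _ _ (cst 1%E)) => //.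
  - by move=> m; exact/measurable_EFinP/measurable_indic.
  - move=> w _; apply: (@indic_cvg (fun m =>
      [set w | X 0 w = k] `&` [set w | X (tau_ m w) w = n])) => {}w.
    by have := state_eventually w; apply: filterS => m /= ->.
  - move=> m w _; rewrite indicE gee0_abs ?lee_fin//.
    by case: (_ \in _).
have p01 m w : (0 <= (p k n (tau_ m w))%:E <= 1)%E.
  rewrite !lee_fin (transition_le1 p_trans)// andbT.
  by case: p_trans => + _ _ _; exact.
have L2 : (P [set w | X 0 w = k] * \int[P]_w (p k n (tau_ m w))%:E)%E
    @[m --> \oo] --> (P [set w | X 0 w = k] * \int[P]_w (p k n (tau w))%:E)%E.
  apply: cvgeZl; first exact: fin_num_measure.
  apply: (@dominated_cvg _ _ _ _ _ measurableT _ _ (cst 1%E)) => //.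
  - move=> w _; apply: cvg_EFin; first exact: nearW.
    exact: transition_cvg.
  - by move=> m w _; have /andP[p0 p1] := p01 m w; rewrite gee0_abs.
move: L1; under eq_fun do rewrite time_changed_grid.
by move=> L1; apply: (cvg_unique _ L1 L2); exact: ereal_hausdorff.
Qed.

End time_change.

(** * Sums over the integers and integrals of integer-valued variables *)

Section integer_valued.
Context (R : realType).

(** Enumerates [0, -1, 1, -2, ...], so that sums over [int] become series that can be integrated
    term by term. *)
Definition nat_to_int (i : nat) : int := if odd i then Negz i./2 else Posz i./2.

Lemma nat_to_int_bij : set_bij [set: nat] [set: int] nat_to_int.
Proof.
split => //.
  by move=> i j _ _; rewrite /nat_to_int; case: ifP; case: ifP; lia.
move=> n _; exists (if 0 <= n then (absz n).*2 else (absz n).*2.-1) => //.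
by rewrite /nat_to_int; case: ifP; case: ifP; lia.
Qed.

Lemma esum_int (a : int -> \bar R) : (forall n, (0 <= a n)%E) ->
  (\esum_(n in [set: int]) a n = \sum_(0 <= i <oo) a (nat_to_int i))%E.
Proof.
move=> a0; rewrite (reindex_esum [set: nat] [set: int] nat_to_int).
  by rewrite nneseries_esumT.
exact: nat_to_int_bij.
Qed.

Lemma integral_esum_int d (W : measurableType d)
    (mu : {measure set W -> \bar R})
    (f : int -> W -> \bar R) :
  (forall n, measurable_fun [set: W] (f n)) -> (forall n w, (0 <= f n w)%E) ->
  (\int[mu]_w (\esum_(n in [set: int]) f n w) =
   \esum_(n in [set: int]) \int[mu]_w f n w)%E.
Proof.
move=> mf f0; rewrite esum_int; last by move=> n; exact: integral_ge0.
rewrite -integral_nneseries//.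
by apply: eq_integral => w _; rewrite esum_int.
Qed.

Lemma measurable_int_valued d (W : measurableType d) (Y : W -> int)
    (A : set int) :
  (forall n, measurable [set w | Y w = n]) -> measurable [set w | A (Y w)].
Proof.
move=> mY; rewrite (_ : [set w | _] =
    \bigcup_i ([set w | Y w = nat_to_int i] `&` [set w | A (nat_to_int i)])).
  apply: bigcupT_measurable => i; apply: measurableI => //.
  have [Ai|nAi] := pselect (A (nat_to_int i)).
    by rewrite (_ : [set w | _] = setT)//; apply/seteqP; split.
  by rewrite (_ : [set w | _] = set0)//; apply/seteqP; split.
apply/seteqP; split => w /=; last by move=> [i _ [/= -> ]].
move=> AY; have [_ _ /(_ (Y w) I)[i _ iY]] := nat_to_int_bij.
by exists i => //; rewrite /= iY.
Qed.

Lemma measurable_fun_int_valued d (W : measurableType d) (Y : W -> int)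
    (f : int -> R) :
  (forall n, measurable [set w | Y w = n]) ->
  measurable_fun [set: W] (fun w => f (Y w)).
Proof.
move=> mY _ B mB; rewrite setTI.
exact: (@measurable_int_valued _ _ Y [set n | B (f n)]).
Qed.

Lemma integral_int_valued d (W : measurableType d)
    (mu : {measure set W -> \bar R})
    (Y : W -> int) (f : int -> R) :
  (forall n, measurable [set w | Y w = n]) -> (forall n, 0 <= f n) ->
  (\int[mu]_w (f (Y w))%:E =
   \esum_(n in [set: int]) ((f n)%:E * mu [set w | Y w = n]))%E.
Proof.
move=> mY f0.
have m1 n : measurable_fun [set: W] (fun w => (\1_[set w | Y w = n] w : R)%:E).
  exact/measurable_EFinP/measurable_indic.
transitivity (\int[mu]_w (\esum_(n in [set: int])
    ((f n)%:E * (\1_[set w | Y w = n] w)%:E)))%E.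
  apply: eq_integral => w _; apply/eqP; rewrite eq_le; apply/andP; split.
    have := @le_seq_esum R _ (fun n => (f n)%:E * (\1_[set w | Y w = n] w)%:E)%E
      [:: Y w] isT.
    by rewrite big_seq1 indicE mem_set// mule1.
  apply: esum_le_seq => s us.
  apply: (@le_trans _ _ (\sum_(n <- s) if n == Y w then (f (Y w))%:E else 0)%E).
    apply: lee_sum => n _; rewrite indicE; case: eqVneq => [->|nY].
      by rewrite mem_set// mule1.
    by rewrite memNset ?mule0// => /esym/eqP; apply/negP.
  rewrite -big_mkcond/=; have [Ys|Ys] := boolP (Y w \in s).
    by rewrite -big_filter filter_pred1_uniq// big_seq1.
  rewrite big1_seq ?lee_fin// => n /andP[/eqP -> nY].
  by rewrite nY in Ys.
rewrite integral_esum_int; last 2 first.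
- by move=> n; apply: measurable_funeM; exact: m1.
- by move=> n w; rewrite mule_ge0// lee_fin.
apply: eq_esum => n _; by rewrite ge0_integralZl_EFin// integral_indic// setIT.
Qed.

End integer_valued.

Section conditioning.
Context (R : realType) d (W : measurableType d) (P : probability W R).

Lemma cond_prob_probability (B : set W) : measurable B -> (0 < P B)%E ->
  exists Q : probability W R, forall A, Q A = cond_prob P A B.
Proof.
move=> mB PB; exists (mnormalize (mrestr P mB) P) => A.
have E : mrestr P mB [set: W] = P B by rewrite /mrestr setTI.
rewrite /= /mnormalize /= E ifF//.
apply/negbTE; rewrite negb_or gt_eqF//= lt_eqF//.
by rewrite -ge0_fin_numE// fin_num_measure.
Qed.

Lemma prob_eq_off_null (A B N : set W) : measurable A -> measurable B ->
  measurable N -> P N = 0%E -> A `\` N = B `\` N -> P A = P B.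
Proof.
move=> mA mB mN PN AB.
have E C : measurable C -> P C = P (C `\` N).
  move=> mC; have mCN := measurableD mC mN.
  apply/eqP; rewrite eq_le; apply/andP; split; last first.
    by apply: le_measure; rewrite ?inE.
  rewrite -[leRHS]adde0 -PN; apply: le_trans (measureU2 _ mCN mN).
  apply: le_measure; rewrite ?inE//; first exact: measurableU.
  by move=> w Cw; have [|] := pselect (N w); [right|left].
by rewrite E// AB -E.
Qed.

End conditioning.

(** * Rates and eigenfunctions of the alternating chain *)

Section alternating.
Context (R : realType) (a1 a2 b1 b2 : R).
Hypotheses (a1_gt0 : 0 < a1) (a2_gt0 : 0 < a2).
Hypotheses (b1_gt0 : 0 < b1) (b2_gt0 : 0 < b2).

Definition up_rate (k : int) : R := if (2 %| k)%Z then a1 else b1.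
Definition down_rate (k : int) : R := if (2 %| k)%Z then a2 else b2.

Definition alternating_exp (g v0 v1 : R) (n : int) : R :=
  expR (g * n%:~R) * (if (2 %| n)%Z then v0 else v1).

Lemma up_rate_ge0 k : 0 <= up_rate k.
Proof. by rewrite /up_rate; case: ifP; rewrite ltW. Qed.

Lemma down_rate_ge0 k : 0 <= down_rate k.
Proof. by rewrite /down_rate; case: ifP; rewrite ltW. Qed.

Lemma rates_le k : up_rate k + down_rate k <= a1 + a2 + b1 + b2.
Proof.
rewrite /up_rate /down_rate; case: ifP => _.
  by rewrite -addrA lerDl addr_ge0// ltW.
by rewrite -[leRHS]addrA lerDr addr_ge0// ltW.
Qed.

Lemma alternating_exp_gt0 g v0 v1 n : 0 < v0 -> 0 < v1 ->
  0 < alternating_exp g v0 v1 n.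
Proof. by move=> ? ?; rewrite mulr_gt0 ?expR_gt0//; case: ifP. Qed.

Lemma drift_alternating_exp g : exists v0 v1, [/\ 0 < v0, 0 < v1 &
  forall k, birth_death_drift up_rate down_rate (alternating_exp g v0 v1) k =
    Lambda a1 a2 b1 b2 g * alternating_exp g v0 v1 k].
Proof.
have [v0 [v1 [v00 v10 e0 e1]]] :=
  Lambda_eigenvector a1_gt0 a2_gt0 b1_gt0 b2_gt0 g.
exists v0, v1; split=> // k.
rewrite /birth_death_drift /alternating_exp /up_rate /down_rate.
have p1 : (2 %| k + 1)%Z = ~~ (2 %| k)%Z by lia.
have p2 : (2 %| k - 1)%Z = ~~ (2 %| k)%Z by lia.
rewrite p1 p2 intrD intrB !mulrDr mulr1 mulrN1 !expRD expRN.
move: e0 e1; rewrite /twisted_rate; set x := expR (g * k%:~R).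
set z := expR g; set z' := z^-1; set L := Lambda _ _ _ _ _ => e0 e1.
case: ifP => _ /=.
  by rewrite [RHS]mulrCA -e0; ring.
by rewrite [RHS]mulrCA -e1; ring.
Qed.

Lemma alternating_exp_growth g v0 v1 n : 0 < v0 -> 0 < v1 ->
  alternating_exp g v0 v1 n <= (v0 + v1) * expR (`|g| * `|n|%N%:R).
Proof.
move=> v00 v10; rewrite /alternating_exp mulrC.
apply: ler_pM; rewrite ?expR_ge0//.
- by case: ifP; rewrite ltW.
- by case: ifP; rewrite ?lerDl ?lerDr ltW.
- by rewrite ler_expR natr_absz intr_norm -normrM ler_norm.
Qed.

Lemma expR_alternating_exp g v0 v1 n : 0 < v0 -> 0 < v1 ->
  (v0 + v1)^-1 * alternating_exp g v0 v1 n <= expR (g * n%:~R) <=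
  (v0^-1 + v1^-1) * alternating_exp g v0 v1 n.
Proof.
move=> v00 v10; rewrite /alternating_exp; set x := expR _.
have x0 : 0 < x by exact: expR_gt0.
set v := if _ then _ else _.
have v_gt0 : 0 < v by rewrite /v; case: ifP.
rewrite ![_ * (x * v)]mulrCA -[X in _ <= X <= _]mulr1 !(ler_pM2l x0).
rewrite ler_pdivrMl ?addr_gt0// mulr1 -ler_pdivrMr// div1r.
apply/andP; split; rewrite /v; case: ifP => _;
  by rewrite ?lerDl ?lerDr ?invr_ge0 ltW.
Qed.

End alternating.

Section time_changed_chain.
Context (R : realType) d (W : measurableType d) (P : probability W R).
Variables (a1 a2 b1 b2 nu : R).
Hypotheses (a1_gt0 : 0 < a1) (a2_gt0 : 0 < a2).
Hypotheses (b1_gt0 : 0 < b1) (b2_gt0 : 0 < b2).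
Hypotheses (nu_gt0 : 0 < nu) (nu_lt1 : nu < 1).
Variables (X1 : R -> W -> int) (p : int -> int -> R -> R) (S : R -> W -> R).
Hypothesis X1_markov : markov_chain P X1 p.
Hypothesis p_generator : has_generator p (alternating_generator a1 a2 b1 b2).
Hypothesis S_stable : stable_subordinator P nu S.
Hypothesis X1_T_indep : independent_processes P [set: set int]
  (measurable : set (set R)) X1 (inverse_process S).

Local Notation T := (inverse_process S).
Let Y t w := X1 (T t w) w.

Let p_gen :
  has_generator p (birth_death_generator (up_rate a1 b1) (down_rate a2 b2)).
Proof. exact: p_generator. Qed.

Let p_trans : transition_function p.
Proof. by case: X1_markov. Qed.

Let p_right k n t : 0 <= t -> p k n s @[s --> t^'+] --> p k n t.
Proof.
apply: (transition_right_continuous p_trans p_gen).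
- by move=> l; exact: up_rate_ge0.
- by move=> l; exact: down_rate_ge0.
Qed.

Let mT t : measurable_fun [set: W] (T t).
Proof. exact: (measurable_inverse_process S_stable). Qed.

Let T_indep t A B : 0 <= t -> process_sigma [set: set int] X1 A ->
  measurable B -> P (A `&` T t @^-1` B) = (P A * P (T t @^-1` B))%E.
Proof.
move=> t0 XA mB; apply: X1_T_indep => //.
by apply: sub_sigma_algebra; exists t, B.
Qed.

Lemma measurable_time_changed_chain t n : 0 <= t ->
  measurable [set w | Y t w = n].
Proof.
move=> t0; apply: (measurable_time_changed X1_markov (mT t)).
exact: inverse_process_ge0.
Qed.

Let mX0 k : measurable [set w | X1 0 w = k].
Proof. by case: X1_markov => _ + _ _; apply. Qed.

Let mN : measurable [set w | T 0 w != 0].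
Proof.
have := mT 0 measurableT (measurableC (measurable_set1 (0 : R))).
rewrite setTI; congr measurable; apply/seteqP; split => w /= h.
  exact/eqP.
by move/eqP: h.
Qed.

(** [T 0 = 0] holds only almost surely, so the initial states of [Y] and [X1] may differ on a null
    event. *)
Let start_off_null (A : set W) k : measurable A ->
  P (A `&` [set w | Y 0 w = k]) = P ([set w | X1 0 w = k] `&` A).
Proof.
move=> mA; apply: (prob_eq_off_null _ _ mN (inverse_process0 nu_gt0 S_stable)).
- by apply: measurableI => //; exact: measurable_time_changed_chain.
- exact: measurableI.
apply/seteqP; split => w [/= [h1 h2] /negP/negPn/eqP h3]; split.
- by split => //; move: h2; rewrite /Y h3.
- by rewrite h3 eqxx.
- by split => //; rewrite /Y h3.
- by rewrite h3 eqxx.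
Qed.

Section conditional_law.
Variables (k : int) (Q : probability W R).
Hypothesis start_gt0 : (0 < P [set w | Y 0 w = k])%E.
Hypothesis QE : forall A, Q A = cond_prob P A [set w | Y 0 w = k].

Lemma conditional_law t n : 0 <= t ->
  Q [set w | Y t w = n] = (\int[P]_w (p k n (T t w))%:E)%E.
Proof.
move=> t0; have mY := measurable_time_changed_chain n t0.
have PE : P [set w | Y 0 w = k] = P [set w | X1 0 w = k].
  by have := start_off_null k measurableT; rewrite setTI setIT.
have h := time_changed_law X1_markov p_right (mT t) (inverse_process_ge0 S t)
  (fun A B => @T_indep t A B t0) k n.
rewrite QE /cond_prob start_off_null// h -PE muleAC.
rewrite -[X in (X * _ * _)%E]fineK ?fin_num_measure//; last first.
  exact: measurable_time_changed_chain.
rewrite -EFinM divff ?mul1e// fine_eq0 ?gt_eqF// fin_num_measure//.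
exact: measurable_time_changed_chain.
Qed.

(** By Tonelli the sum over states moves inside the integral, where it is the mean of the
    eigenfunction at the fixed time [T t w]. *)
Lemma conditional_alternating_exp (g v0 v1 : R) t :
  0 <= t -> 0 < v0 -> 0 < v1 ->
  (forall l,
    birth_death_drift (up_rate a1 b1) (down_rate a2 b2)
      (alternating_exp g v0 v1) l =
    Lambda a1 a2 b1 b2 g * alternating_exp g v0 v1 l) ->
  (\int[Q]_w (alternating_exp g v0 v1 (Y t w))%:E =
   (alternating_exp g v0 v1 k)%:E * 'M_P (T t) (Lambda a1 a2 b1 b2 g))%E.
Proof.
move=> t0 v00 v10 eigen; pose u := alternating_exp g v0 v1.
have u0 n : 0 <= u n by exact/ltW/alternating_exp_gt0.
have T0 w : 0 <= T t w by exact: inverse_process_ge0.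
have p0 n w : 0 <= p k n (T t w) by case: p_trans => + _ _ _; exact.
have mp n : measurable_fun [set: W] (fun w => (p k n (T t w))%:E).
  exact: (transition_time_changed_measurable p_right (mT t)
    (inverse_process_ge0 S t) k n).
rewrite (integral_int_valued _ (Y := Y t))//; last first.
  by move=> n; exact: measurable_time_changed_chain.
transitivity (\esum_(n in [set: int]) \int[P]_w (p k n (T t w) * u n)%:E)%E.
  apply: eq_esum => n _.
  have -> : ((alternating_exp g v0 v1 n)%:E * Q [set w | Y t w = n] =
      (u n)%:E * \int[P]_w (p k n (T t w))%:E)%E.
    by congr (_ * _)%E; exact: conditional_law.
  rewrite -ge0_integralZl_EFin//; last first.
    by move=> w _; rewrite lee_fin.
  by apply: eq_integral => w _; rewrite EFinM muleC.
rewrite -integral_esum_int; last 2 first.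
- by move=> n; under eq_fun do rewrite EFinM; exact: emeasurable_funM.
- by move=> n w; rewrite lee_fin mulr_ge0.
rewrite mmt_gen_funE -ge0_integralZl_EFin//; last first.
  exact: measurable_expRM.
apply: eq_integral => w _.
have -> : (\esum_(n in [set: int]) (p k n (T t w) * u n)%:E =
    (expR (Lambda a1 a2 b1 b2 g * T t w) * u k)%:E)%E.
  have u_growth l : u l <= (v0 + v1) * expR (`|g| * `|l|%N%:R).
    exact: alternating_exp_growth.
  apply: (@transition_exponential_mean _ _ _ _ (a1 + a2 + b1 + b2) p_trans p_gen
    _ _ _ u (Lambda a1 a2 b1 b2 g) _ _ `|g| (v0 + v1)) => //.
  - by move=> l; exact: up_rate_ge0.
  - by move=> l; exact: down_rate_ge0.
  - by move=> l; exact: rates_le.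
  - by move=> l; exact: alternating_exp_gt0.
by rewrite EFinM muleC.
Qed.

Lemma conditional_mmt_asymp (g eta : R) : 0 < eta -> \forall t \near +oo,
  ((expR (t * (Lambda_nu a1 a2 b1 b2 nu g - eta)))%:E <=
   'M_Q (fun w => (Y t w)%:~R) g <=
   (expR (t * (Lambda_nu a1 a2 b1 b2 nu g + eta)))%:E)%E.
Proof.
move=> eta0; have [v0 [v1 [v00 v10 eigen]]] :=
  drift_alternating_exp a1_gt0 a2_gt0 b1_gt0 b2_gt0 g.
pose u := alternating_exp g v0 v1.
have u_gt0 n : 0 < u n by exact: alternating_exp_gt0.
have eta20 : 0 < eta / 2 by rewrite divr_gt0.
have H := mmt_inverse_process_asymp nu_gt0 nu_lt1 S_stable
  (Lambda a1 a2 b1 b2 g) eta20.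
(* Constants of the comparison of [exp (g n)] with [u n], times the initial value [u k]; they do not
   depend on [t], and [exp (t eta / 2)] absorbs them. *)
pose cl := (v0 + v1)^-1 * u k; pose cu := (v0^-1 + v1^-1) * u k.
have cl0 : 0 < cl by rewrite mulr_gt0// invr_gt0 addr_gt0.
have cu0 : 0 < cu by rewrite mulr_gt0// addr_gt0 ?invr_gt0.
near=> t; have t0 : 0 < t by near: t; exact: nbhs_pinfty_gt.
have mY n := measurable_time_changed_chain n (ltW t0).
have mu_ (c : R) : measurable_fun [set: W] (fun w => (c%:E * (u (Y t w))%:E)%E).
  apply: measurable_funeM; apply/measurable_EFinP.
  exact: (measurable_fun_int_valued u mY).
have mean c : 0 <= c -> (\int[Q]_w (c%:E * (u (Y t w))%:E) =
    (c * u k)%:E * 'M_P (T t) (Lambda a1 a2 b1 b2 g))%E.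
  move=> c0; rewrite ge0_integralZl_EFin//; last 2 first.
  - by move=> w _; rewrite lee_fin ltW.
  - by apply/measurable_EFinP; exact: (measurable_fun_int_valued u mY).
  by rewrite (conditional_alternating_exp (ltW t0) v00 v10 eigen) EFinM muleA.
have /andP[lo up] : ((expR (t * (Lambda_nu a1 a2 b1 b2 nu g - eta / 2)))%:E <=
    'M_P (T t) (Lambda a1 a2 b1 b2 g) <=
    (expR (t * (Lambda_nu a1 a2 b1 b2 nu g + eta / 2)))%:E)%E.
  by near: t; exact: H.
have mexp : measurable_fun [set: W] (fun w => (expR (g * (Y t w)%:~R))%:E).
  apply: measurable_expRM.
  exact: (measurable_fun_int_valued (fun n => n%:~R) mY).
have bnd w := expR_alternating_exp g (Y t w) v00 v10.
have i0 : 0 <= (v0 + v1)^-1 by rewrite invr_ge0 addr_ge0 ?(ltW v00) ?(ltW v10).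
have j0 : 0 <= v0^-1 + v1^-1 by rewrite addr_ge0// invr_ge0 ltW.
rewrite mmt_gen_funE; apply/andP; split.
- apply: (@le_trans _ _
    (\int[Q]_w (((v0 + v1)^-1)%:E * (u (Y t w))%:E))%E); last first.
    apply: ge0_le_integral => //.
    - by move=> w _; rewrite mule_ge0// lee_fin// ltW.
    - by move=> w _; rewrite -EFinM lee_fin; have /andP[] := bnd w.
  rewrite mean// -/cl.
  apply: (@le_trans _ _ (cl%:E *
      (expR (t * (Lambda_nu a1 a2 b1 b2 nu g - eta / 2)))%:E)%E); last first.
    by rewrite lee_wpmul2l// lee_fin ltW.
  rewrite -EFinM lee_fin -[cl]lnK ?posrE// -expRD ler_expR.
  have : - (t * (eta / 2)) <= ln cl; last by lra.
  by rewrite lerNl -ler_pdivrMr.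
- apply: (@le_trans _ _ (\int[Q]_w ((v0^-1 + v1^-1)%:E * (u (Y t w))%:E))%E).
    apply: ge0_le_integral => //.
    by move=> w _; rewrite -EFinM lee_fin; have /andP[] := bnd w.
  rewrite mean// -/cu.
  apply: (@le_trans _ _ (cu%:E *
      (expR (t * (Lambda_nu a1 a2 b1 b2 nu g + eta / 2)))%:E)%E).
    by rewrite lee_wpmul2l// lee_fin ltW.
  rewrite -EFinM lee_fin -[cu]lnK ?posrE// -expRD ler_expR.
  have : ln cu <= t * (eta / 2); last by lra.
  by rewrite -ler_pdivrMr.
Unshelve. all: by end_near. Qed.

End conditional_law.
End time_changed_chain.
Unset Implicit Arguments.

Theorem proposition4p2 (R : realType) (d : measure_display)
    (W : measurableType d) (P : probability W R)
    (a1 a2 b1 b2 nu : R)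
    (a1_gt0 : 0 < a1) (a2_gt0 : 0 < a2) (b1_gt0 : 0 < b1) (b2_gt0 : 0 < b2)
    (nu_gt0 : 0 < nu) (nu_lt1 : nu < 1)
    (X1 : R -> W -> int) (p : int -> int -> R -> R) (S : R -> W -> R)
    (X1_markov : markov_chain P X1 p)
    (p_generator : has_generator p (alternating_generator a1 a2 b1 b2))
    (S_stable : stable_subordinator P nu S)
    (X1_T_indep : independent_processes P [set: set int]
      (measurable : set (set R)) X1 (inverse_process S)) :
  let Xnu := fun (t : R) (w : W) => X1 (inverse_process S t w) w in
  forall k : int, (0 < P [set w | Xnu 0%R w = k])%E ->
    satisfies_LDP
      (fun (t : R) (A : set R) =>
         cond_prob P [set w | A ((Xnu t w)%:~R / t)] [set w | Xnu 0 w = k])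
      (fun t : R => t)
      (Lambda_nu_star a1 a2 b1 b2 nu) /\
    good_rate_function (Lambda_nu_star a1 a2 b1 b2 nu).
Proof.
move=> Xnu k k_gt0; split; last first.
  exact: (@legendre_good R (Lambda_nu a1 a2 b1 b2 nu)).
have mXnu t n : 0 <= t -> measurable [set w | Xnu t w = n].
  exact: (measurable_time_changed_chain X1_markov S_stable).
(* Conditioning is done once for all [t]: the conditional laws become laws of [Xnu t / t] under the
   single probability [Q]. *)
have [Q QE] := cond_prob_probability (mXnu 0 k (lexx 0)) k_gt0.
under eq_fun do under eq_fun do rewrite -QE.
apply: (gartner_ellis (Z := fun t w => (Xnu t w)%:~R)).
- move=> t t0; apply: (measurable_fun_int_valued (fun n => n%:~R)) => n.
  by apply: mXnu; exact: ltW.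
- move=> g eta; exact: (conditional_mmt_asymp a1_gt0 a2_gt0 b1_gt0 b2_gt0 nu_gt0
    nu_lt1 X1_markov p_generator S_stable X1_T_indep k_gt0 QE).
- by move=> g; exact: derivable_Lambda_nu.
- exact: superlinear_Lambda_nu.
- exact: Lambda_nu0.
Qed.
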